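(* For every $\varepsilon>0$ there exists $K$ such that if $k\in\mathbb{N}$ with $k\geq K$ and $T$ is a metric tree with $|T|\leq (1-\varepsilon)k^2$, then $(1,2,\dots,k)$ is a cover of $T$.
   Context: A metric tree $T$ is obtained from a finite tree with at least one vertex by replacing each edge by a closed real interval of positive length whose endpoints are identified with the end vertices of the edge; $|T|$ denotes the sum of the lengths of these intervals, and $d_T$ is the path-length metric on $T$. For $v\in T$ and $r\ge 0$, $B_T(v,r)=\{u\in T: d_T(v,u)\leq r\}$. A finite sequence $(r_1,\dots,r_m)$ of non-negative reals is a cover of $T$ if there exist $v_1,\dots,v_m\in T$ with $T=\bigcup_{i=1}^m B_T(v_i,r_i)$. *)

(* Defs.v *)
From HB Require Import structures.
From mathcomp Require Import all_boot all_order all_algebra.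
From mathcomp Require Import mathcomp_extra boolp classical_sets reals.
Set Implicit Arguments.
Unset Strict Implicit.
Unset Printing Implicit Defensive.
Import Order.TTheory GRing.Theory Num.Theory.
Local Open Scope classical_set_scope.
Local Open Scope ring_scope.

(* A simple graph (V, adj) is a tree: nonempty, connected, and with no cycle
   on three or more distinct vertices. *)
Definition is_tree (V : finType) (adj : rel V) : Prop :=
  [/\ symmetric adj, irreflexive adj, (0 < #|V|)%N,
      forall u v, connect adj u v
    & forall c : seq V, (2 < size c)%N -> ~~ ucycleb adj c].

Record metric_tree (R : realType) := MetricTree {
  vertex : finType;
  adj : rel vertex;
  treeP : is_tree adj;
  len : vertex -> vertex -> R;
  len_sym : forall u v, len u v = len v u;
  len_gt0 : forall u v, adj u v -> 0 < len u v
}.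

Section MetricTree.
Variables (R : realType) (T : metric_tree R).

(* The values of [len] at nonadjacent pairs are never used.  [oedge] selects
   one of the two orientations (u, v), (v, u) of each edge. *)
Definition oedge (u v : vertex T) : bool :=
  adj u v && (enum_rank u < enum_rank v)%N.

Definition total_length : R :=
  \sum_(e : vertex T * vertex T | oedge e.1 e.2) len e.1 e.2.

(* The points of the space obtained by gluing the intervals [0, len u v] to
   the vertices, each listed exactly once: the vertices, and the interior
   points of the edges.  [InnerPt u v t _ _] lies on the edge uv at distance t
   from u along that edge. *)
Inductive point : Type :=
| VertexPt (v : vertex T)
| InnerPt (u v : vertex T) (t : R) of oedge u v & 0 < t < len u v.

Fixpoint walk_length (u : vertex T) (p : seq (vertex T)) : R :=
  if p is v :: p' then len u v + walk_length v p' else 0.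

(* [stub x u a]: a segment of length a, inside a single edge (or reduced to a
   vertex), joins x to the vertex u. *)
Inductive stub : point -> vertex T -> R -> Prop :=
| StubVertex v : stub (VertexPt v) v 0
| StubLeft u v t (e : oedge u v) (ht : 0 < t < len u v) :
    stub (InnerPt e ht) u t
| StubRight u v t (e : oedge u v) (ht : 0 < t < len u v) :
    stub (InnerPt e ht) v (len u v - t).

(* Lengths of the paths between two points: either a segment inside one edge,
   or a path through at least one vertex. *)
Inductive path_len (x y : point) : R -> Prop :=
| PathThrough u (p : seq (vertex T)) a b :
    stub x u a -> path (@adj R T) u p -> stub y (last u p) b ->
    path_len x y (a + walk_length u p + b)
| PathInside u v s t (e : oedge u v)
    (hs : 0 < s < len u v) (ht : 0 < t < len u v) :
    x = InnerPt e hs -> y = InnerPt e ht ->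
    path_len x y `|s - t|.

Definition dist (x y : point) : R := inf [set d | path_len x y d].

Definition tball (v : point) (r : R) : set point := [set u | dist v u <= r].

Definition is_cover (r : seq R) : Prop :=
  {in r, forall x, 0 <= x} /\
  exists v : 'I_(size r) -> point,
    [set: point] = \bigcup_i tball (v i) r`_i.

End MetricTree.

(* Main.v *)
(* Cut the tree, discretised with mesh about k/q, into pieces of bounded size and
   cover them one after the other, each time as cheaply as possible for weights
   w_1, ..., w_q on the radii equal to the current overuse of each radius; the sum
   of the squared overuses then grows only linearly. So it is enough to cover a
   tree with n vertices at a cost of n (w_1 + ... + w_q) / q^2 + w_q, and w may be
   taken nondecreasing. Let a minimise (w_1 + ... + w_a) / a^2. Decompose the tree
   into longest paths and cover each by consecutive balls of radius a, the last one
   shortened to end at the leaf. If a path of l vertices branches off at a vertex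
   around which radius i is still covered, its first ball may either start i
   vertices after that vertex, or start i vertices before it. Over all i < a and
   both options, each of the 2a phases of the path occurs at most once; hence the
   radius left at any later branching is again equidistributed, and the path costs
   on average at most l (w_1 + ... + w_a) / a^2. *)

From HB Require Import structures.
Require Import Defs.
From mathcomp Require Import all_boot all_order all_algebra.
From mathcomp Require Import mathcomp_extra boolp classical_sets reals.
From mathcomp Require Import zify ring lra.
(* [classical_sets] also exports a constant [point]. *)
Import Defs.
Set Implicit Arguments.
Unset Strict Implicit.
Unset Printing Implicit Defensive.
Import Order.TTheory GRing.Theory Num.Theory.
Local Open Scope ring_scope.

(** * Rooted forests in first-child, next-sibling form *)

(* [Branch x s r], hung at a vertex v: v has a child x, s hangs at x and r at v. *)
Inductive forest (A : Type) : Type :=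
| Empty
| Branch of A & forest A & forest A.
Arguments Empty {A}.

Section Forest.
Variable A : Type.

Fixpoint fsize (t : forest A) : nat :=
  if t is Branch _ s r then (fsize s + fsize r).+1 else 0.

Fixpoint fheight (t : forest A) : nat :=
  if t is Branch _ s r then maxn (fheight s).+1 (fheight r) else 0.

Fixpoint infor (y : A) (t : forest A) : Prop :=
  if t is Branch x s r then [\/ y = x, infor y s | infor y r] else False.

Lemma fheight_size t : (fheight t <= fsize t)%N.
Proof. by elim: t => //= x s IHs r IHr; lia. Qed.

End Forest.

(** * Cost of a path averaged over the phases of its first ball *)

Section PathCost.
Variables (R : realFieldType) (w : nat -> R) (a : nat).
Hypotheses (a0 : (0 < a)%N) (w0 : w 0 = 0).

Definition cumul (n : nat) : R := \sum_(1 <= j < n.+1) w j.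

(* The cost of n consecutive vertices of a path, 2a of them for each ball of
   radius a, the rest in one smaller ball. *)
Definition chain_cost (n : nat) : R :=
  (n %/ (2 * a))%:R * w a + w ((n %% (2 * a)).+1)./2.

Lemma chain_costD n : chain_cost (n + 2 * a) = chain_cost n + w a.
Proof.
rewrite /chain_cost modnDr divnDr ?dvdnn// divnn muln_gt0 a0 /= addn1.
by rewrite -natr1; ring.
Qed.

Lemma chain_cost_small n : (n <= 2 * a)%N -> chain_cost n = w (n.+1)./2.
Proof.
rewrite leq_eqVlt => /orP[/eqP->|lt_n].
  rewrite -[(2 * a)%N]add0n chain_costD /chain_cost mod0n div0n w0 mul0r !add0r.
  by congr w; lia.
by rewrite /chain_cost modn_small// divn_small// mul0r add0r.
Qed.

(* The two phases of a path of l vertices, for each residual radius i < m. *)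
Definition window (l m : nat) : R :=
  \sum_(i < m) (chain_cost (l - i) + chain_cost (l.+1 + i)).

(** The lengths that occur are [1, ..., 2 * l], once each, and lengths [2 * j - 1] and [2 * j] both
    take one ball of radius [j]. *)
Lemma window_small l : (l <= a)%N -> window l l = 2 * cumul l.
Proof.
move=> le_la; rewrite /window.
have -> : \sum_(i < l) (chain_cost (l - i) + chain_cost (l.+1 + i)) =
    \sum_(1 <= n < (2 * l).+1) chain_cost n.
  rewrite big_split /= [RHS](@big_cat_nat _ _ _ l.+1) /=; [|lia|lia].
  congr (_ + _).
    rewrite big_add1 /= big_mkord [LHS](reindex_inj rev_ord_inj) /=.
    by apply: eq_bigr => i _; congr chain_cost; have := ltn_ord i; lia.
  rewrite (_ : \sum_(l.+1 <= i < _) _ = \sum_(0 <= i < l) chain_cost (i + l.+1)).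
    by rewrite big_mkord; apply: eq_bigr => i _; rewrite addnC.
  rewrite -{1}[l.+1]add0n big_addn.
  by rewrite (_ : (2 * l).+1 - l.+1 = l)%N; last lia.
elim: l le_la => [|l IHl] le_la; first by rewrite /cumul !big_geq// mulr0.
rewrite /cumul (_ : (2 * l.+1).+1 = (2 * l).+3)%N; last lia.
rewrite [LHS]big_nat_recr //= [X in X + _]big_nat_recr //= IHl; last lia.
rewrite [X in _ = 2 * X]big_nat_recr //= -/(cumul l).
rewrite !chain_cost_small; try lia.
rewrite (_ : (2 * l).+2./2 = l.+1)%N; last lia.
by rewrite (_ : (2 * l).+3./2 = l.+1)%N; [ring|lia].
Qed.

(** The window holds the [2 * a] consecutive lengths from [l - a + 1] to [l + a]. Raising [l] drops
    the smallest and adds one longer by [2 * a], that is, by one ball of radius [a]. *)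
Lemma window_shift l : (a <= l)%N -> window l.+1 a = window l a + w a.
Proof.
move=> le_al; rewrite /window; case: a a0 le_al chain_costD => // b _ le_bl CD.
rewrite [X in _ = X + _]big_split big_split /=.
rewrite [X in X + _ = _]big_ord_recl [X in _ + X = _]big_ord_recr /=.
rewrite [X in _ = X + _ + _]big_ord_recr [X in _ = _ + X + _]big_ord_recl /=.
have -> : (l.+2 + b = (l - b) + 2 * b.+1)%N by lia.
rewrite CD addn0 subn0.
have -> : \sum_(i < b) chain_cost (l.+1 - bump 0 i) =
    \sum_(i < b) chain_cost (l - i).
  by apply: eq_bigr => i _; rewrite /bump /=; congr chain_cost; lia.
have -> : \sum_(i < b) chain_cost (l.+1 + bump 0 i) =
    \sum_(i < b) chain_cost (l.+2 + i).
  by apply: eq_bigr => i _; rewrite /bump /=; congr chain_cost; lia.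
ring.
Qed.

Lemma window_large l : (a <= l)%N ->
  window l a = 2 * cumul a + (l - a)%:R * w a.
Proof.
move=> /subnKC {1}<-; elim: (l - a)%N => [|n IHn].
  by rewrite addn0 window_small// mul0r addr0.
rewrite addnS window_shift ?leq_addr// IHn -natr1; ring.
Qed.

Hypotheses (w_last : w a * a%:R <= 2 * cumul a)
  (w_mean : forall l, (l <= a)%N -> cumul l * a%:R <= l%:R * cumul a).

(** Up to length [a] this is [w_mean]; each further vertex adds [w a], which [w_last] bounds by
    [2 * (cumul a / a%:R)]. *)
Lemma window_le l : window l (minn a l) <= 2 * (cumul a / a%:R) * l%:R.
Proof.
have aR : (0 : R) < a%:R by rewrite ltr0n.
rewrite -(ler_pM2r aR) [leRHS](_ : _ = 2 * cumul a * l%:R); last first.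
  by field; rewrite gt_eqF.
case: (leqP l a) => [le_la|lt_al].
  rewrite window_small//.
  by have := w_mean le_la; nra.
rewrite window_large ?(ltnW lt_al)//.
rewrite (_ : l%:R = (l - a)%:R + a%:R :> R); last by rewrite -natrD subnK// ltnW.
have : (0 : R) <= (l - a)%:R by [].
move: w_last; set d := (l - a)%:R; nra.
Qed.

End PathCost.

(** * Covering a hung forest along longest paths *)

Section ForestCover.
Variables (R : realFieldType) (X : eqType) (near : nat -> X -> X -> Prop).
Hypotheses (near0 : forall x, near 0 x x)
  (near_sym : forall n x y, near n x y -> near n y x)
  (near_trans : forall m n x y z, near m x y -> near n y z -> near (m + n) x z).

Fixpoint hung (v : X) (t : forest X) : Prop :=
  if t is Branch x s r then [/\ near 1 v x, hung x s & hung v r] else True.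

(* Some ball of l still covers everything within n of v. *)
Definition grants (l : seq (X * nat)) (v : X) (n : nat) : Prop :=
  exists b i, [/\ b \in l, near i b.1 v & (i + n <= b.2)%N].

Lemma grants_le l v m n : (n <= m)%N -> grants l v m -> grants l v n.
Proof. by move=> le_nm [b [i [? ? ?]]]; exists b, i; split=> //; lia. Qed.

Lemma grants_near l u v m n : near m u v -> grants l u (m + n) -> grants l v n.
Proof.
move=> uv [b [i [bl bu le_b]]]; exists b, (i + m)%N; split=> //; last by lia.
exact: near_trans bu uv.
Qed.

Lemma grants_in (l : seq (X * nat)) v n : (v, n) \in l -> grants l v n.
Proof. by move=> vl; exists (v, n), 0; split. Qed.

Lemma hung_near v t y : hung v t -> infor y t ->
  exists n, (n <= fheight t)%N /\ near n v y.
Proof.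
elim: t v => //= x s IHs r IHr v [vx hs hr] [->||].
- by exists 1; split=> //; rewrite leq_max.
- move=> /(IHs _ hs)[n [le_n xy]]; exists (1 + n)%N; split; first by lia.
  exact: near_trans vx xy.
- by move=> /(IHr _ hr)[n [le_n xy]]; exists n; split=> //; lia.
Qed.

Variables (w : nat -> R) (a : nat).
Hypotheses (a0 : (0 < a)%N) (w0 : w 0 = 0) (w_ge0 : forall i, 0 <= w i)
  (w_last : w a * a%:R <= 2 * cumul w a)
  (w_mean : forall l, (l <= a)%N -> cumul w l * a%:R <= l%:R * cumul w a).

Let kappa : R := cumul w a / a%:R.
Let C := chain_cost w a.

Definition weight (l : seq (X * nat)) : R := \sum_(b <- l) w b.2.

(** Quantifying over all lists that contain [l] lets covers of different parts be concatenated, each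
    relying on balls bought for another. *)
Definition covers (t : forest X) (c : R) (pre post : seq (X * nat) -> Prop) :=
  exists l, [/\ (size l <= fsize t)%N, all (fun b => 0 < b.2 <= a)%N l,
    weight l <= c &
    forall l', {subset l <= l'} -> pre l' ->
      post l' /\ forall y, infor y t -> grants l' y 0].

(* The number of vertices that follow v in the current ball, when the ball started
   s vertices before v and the longest path below v has h vertices. The centre of
   the ball is still to come if s is smaller than that. *)
Definition ahead (h s : nat) := minn (2 * a - s.+1) h.

(** A ball whose centre is still to come is unpaid, so the chain to pay runs from its start, [s]
    vertices before [v], to the leaf. Otherwise only the vertices beyond the ball are left to
    pay. *)
Definition state_cost (h s : nat) : R :=
  if (s < ahead h s)%N then C (s.+1 + h)%N else C (h - ahead h s)%N.

Definition state_pre (v : X) (h s : nat) (l : seq (X * nat)) : Prop :=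
  (s < ahead h s)%N \/ grants l v (ahead h s).

(** A ball bought below [v] reaches back to its start, [s] steps from [v]. *)
Definition state_post (v : X) (h s : nat) (l : seq (X * nat)) : Prop :=
  (s < ahead h s)%N -> grants l v s.

Definition next (s : nat) : nat := if (s.+1 < 2 * a)%N then s.+1 else 0.

Lemma next_lt s : (next s < 2 * a)%N.
Proof. by rewrite /next; case: ifP => //; lia. Qed.

Lemma sum_next (f : nat -> R) : \sum_(s < 2 * a) f (next s) = \sum_(s < 2 * a) f s.
Proof.
have /prednK a2 : (0 < 2 * a)%N by lia.
rewrite -a2 big_ord_recr [RHS]big_ord_recl /= addrC.
congr (f _ + _); first by rewrite /next a2 ltnn.
apply: eq_bigr => i _; rewrite /next /bump /=.
by rewrite ifT; [congr f; lia|have := ltn_ord i; lia].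
Qed.

Lemma sum_fold (f : nat -> R) :
  \sum_(s < 2 * a) f s = \sum_(i < a) (f (2 * a - i.+1)%N + f i).
Proof.
rewrite mul2n -addnn big_split_ord /= big_split /= addrC; congr (_ + _).
rewrite [LHS](reindex_inj rev_ord_inj); apply: eq_bigr => i _ /=.
by congr f; have := ltn_ord i; lia.
Qed.

(** The step from [v] to [x] advances the phase. A ball is bought only if [x] is to be its centre,
    and the drop of [state_cost] pays for it. *)
Lemma covers_edge v x t c s : near 1 v x -> (s < 2 * a)%N ->
  let h := fheight t in
  covers t (state_cost h (next s) + c)
    (state_pre x h (next s)) (state_post x h (next s)) ->
  covers (Branch x t Empty) (state_cost h.+1 s + c)
    (state_pre v h.+1 s) (state_post v h.+1 s).
Proof.
move=> vx lt_s h [l [sz_l ok_l le_l cov_l]].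
have covx l' y : grants l' x 0 -> (infor y t -> grants l' y 0) ->
  infor y (Branch x t Empty) -> grants l' y 0 by move=> ? ? [->||].
have free : state_cost h (next s) <= state_cost h.+1 s ->
    (forall l', {subset l <= l'} -> state_pre v h.+1 s l' ->
      state_pre x h (next s) l') ->
    (forall l', state_pre v h.+1 s l' -> state_post x h (next s) l' ->
      state_post v h.+1 s l' /\ grants l' x 0) ->
    covers (Branch x t Empty) (state_cost h.+1 s + c)
      (state_pre v h.+1 s) (state_post v h.+1 s).
  move=> le_c pre post; exists l; split=> //=; first lia.
    by apply: le_trans le_l _; rewrite lerD2r.
  move=> l' sub_l pre'; have [post' cov'] := cov_l _ sub_l (pre _ sub_l pre').
  have [? ?] := post _ pre' post'; split=> // y.
  by apply: covx => //; exact: cov'.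
have paid r : (0 < r <= a)%N ->
    state_cost h (next s) + w r <= state_cost h.+1 s ->
    (ahead h (next s) <= r)%N -> ((s < ahead h.+1 s)%N -> (s < r)%N) ->
    covers (Branch x t Empty) (state_cost h.+1 s + c)
      (state_pre v h.+1 s) (state_post v h.+1 s).
  move=> r_ok le_c le_e lt_r; exists ((x, r) :: l); split=> /=.
  - by lia.
  - by rewrite r_ok.
  - rewrite /weight big_cons /= -/(weight l).
    by apply: le_trans (lerD (lexx _) le_l) _; lra.
  move=> l' sub_l pre'.
  have xl : grants l' x r by apply/grants_in/sub_l; rewrite mem_head.
  have [] := cov_l l'.
  - by move=> b bl; apply: sub_l; rewrite inE bl orbT.
  - by right; apply: grants_le xl.
  move=> _ cov'; split.
    move=> /lt_r lt_sr; apply: grants_near (near_sym vx) _.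
    exact: grants_le xl.
  move=> y; apply: covx; last exact: cov'.
  exact: grants_le xl.
(* In the last phase the ball ends at [v] and the next one starts at [x]; it is bought at once only
   if [x] is a leaf. *)
have [s_last|s_next] := eqVneq s (2 * a).-1.
  have ns : next s = 0 by rewrite /next ifF//; lia.
  have e0 : ahead h.+1 s = 0 by rewrite /ahead; lia.
  have [h0|h_gt0] := posnP h.
    apply: (paid 1) => //; last by rewrite e0.
      rewrite /state_cost e0 ns h0 /ahead minn0 /= subnn /C.
      by rewrite !chain_cost_small //=; [rewrite w0 add0r|lia].
    by rewrite /ahead h0 minn0.
  have e1 : (0 < ahead h 0)%N by rewrite /ahead; lia.
  apply: free; rewrite /state_cost /state_pre /state_post ns e0 e1 //=.
  - by move=> *; left.
  - by move=> l' _ /(_ isT) ?; split.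
have ns : next s = s.+1 by rewrite /next ifT//; lia.
have e1 : (0 < ahead h.+1 s)%N by rewrite /ahead; lia.
have eS : ahead h.+1 s = (ahead h s.+1).+1 by rewrite /ahead; lia.
have [lt_se|le_es] := ltnP s (ahead h.+1 s); last first.
  have nlt : (s.+1 < ahead h s.+1)%N = false by lia.
  apply: free; rewrite /state_cost /state_pre /state_post ns nlt.
  - by rewrite ltnNge le_es /= eS subSS.
  - move=> l' _ [|]; first by rewrite ltnNge le_es.
    by rewrite eS -add1n => g; right; exact: grants_near vx g.
  - move=> l' [|]; first by rewrite ltnNge le_es.
    rewrite eS -add1n => g _; split; first by lia.
    by apply: grants_near vx _; apply: grants_le g; lia.
have [lt_se'|le_es'] := ltnP s.+1 (ahead h s.+1).
  apply: free; rewrite /state_cost /state_pre /state_post ns lt_se' lt_se.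
  - by rewrite (_ : s.+2 + h = s.+1 + h.+1)%N//; lia.
  - by move=> *; left.
  - move=> l' _ /(_ isT) g; split; last exact: grants_le g.
    by move=> _; apply: grants_near (near_sym vx) _; rewrite add1n.
(* Now [x] is the centre. The ball spans [s] vertices before [v], [v] itself and [ahead h.+1 s]
   vertices after it; its radius is half their number, rounded up. *)
apply: (paid ((s.+1 + ahead h.+1 s).+1)./2); [| |rewrite ns; lia|lia].
  by rewrite /ahead; lia.
rewrite /state_cost ns lt_se ifF; last by rewrite ltnNge le_es'.
(* Either this ball is the last one, shortened to end at the leaf, or it has the full radius [a] and
   [chain_costD] splits it off. *)
have [le_h|lt_h] := leqP h.+1 (2 * a - s.+1).
  have -> : ahead h.+1 s = h.+1 by rewrite /ahead; lia.
  have -> : (h - ahead h s.+1 = 0)%N by rewrite /ahead; lia.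
  by rewrite /C !chain_cost_small ?w0 ?add0r //; lia.
have e2 : (s.+1 + ahead h.+1 s = 2 * a)%N by rewrite /ahead; lia.
rewrite e2 (_ : (2 * a).+1./2 = a)%N; last lia.
rewrite /C -chain_costD// (_ : _ + 2 * a = s.+1 + h.+1)%N//.
by rewrite /ahead; lia.
Qed.


(** The radius around [v] that the ball of the main path leaves to a side branch. *)
Definition residual (h s : nat) : nat := minn s (ahead h s).

(** Before truncation at [h], each [i < a] is the residual of exactly the two phases [i] and
    [2 * a - i.+1]; truncation only replaces terms by [f h = 0]. So the radius left at a branching
    is equidistributed. *)
Lemma sum_residual (f : nat -> R) h : (forall i, 0 <= f i) -> f h = 0 ->
  \sum_(s < 2 * a) f (residual h s) <= 2 * \sum_(i < a) f i.
Proof.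
move=> f_ge0 fh; rewrite (sum_fold (fun s => f (residual h s))) mulr_sumr.
apply: ler_sum => i _; have := ltn_ord i; have := f_ge0 i => fi lt_i.
have res s : (minn s (2 * a - s.+1) = i)%N -> f (residual h s) <= f i.
  move=> es; have [->//|->] : residual h s = i \/ residual h s = h.
    by rewrite /residual /ahead minnA es /minn; case: ifP; [left|right].
  by rewrite fh.
have le1 : f (residual h (2 * a - i.+1)) <= f i by apply: res; lia.
have le2 : f (residual h i) <= f i by apply: res; lia.
lra.
Qed.

Lemma residual_lt h s : (s < 2 * a)%N -> (residual h s < a)%N.
Proof. by rewrite /residual /ahead; lia. Qed.

(* [alpha i] bounds the cost of covering [t] when the points within distance i
   of v are already covered; [state_cost + gamma s] bounds it when the longest
   path of [t] is traversed by consecutive balls of 2a vertices, the current one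
   having started s vertices before v. *)
Definition affordable (v : X) (t : forest X) : Prop :=
  exists alpha gamma : nat -> R,
  [/\ [/\ forall i, 0 <= alpha i, forall s, 0 <= gamma s &
        forall i, (fheight t <= i)%N -> alpha i = 0],
      \sum_(i < a) alpha i <= kappa * (fsize t)%:R,
      \sum_(s < 2 * a) gamma s <= 2 * kappa * (fsize t - fheight t)%:R,
      forall i, (i < a)%N -> covers t (alpha i) (fun l => grants l v i) xpredT &
      forall s, (s < 2 * a)%N ->
        covers t (state_cost (fheight t) s + gamma s)
          (state_pre v (fheight t) s) (state_post v (fheight t) s)].

Lemma weight_cat l1 l2 : weight (l1 ++ l2) = weight l1 + weight l2.
Proof. by rewrite /weight big_cat. Qed.

Lemma kappa_ge0 : 0 <= kappa.
Proof. by rewrite /kappa divr_ge0// sumr_ge0. Qed.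

Lemma state_cost_ge0 h s : 0 <= state_cost h s.
Proof.
by rewrite /state_cost; case: ifP => _; rewrite /C /chain_cost addr_ge0// mulr_ge0.
Qed.

Lemma affordable_empty v : affordable v Empty.
Proof.
exists (fun=> 0), (fun=> 0); split=> //=.
- by rewrite big1// mulr0.
- by rewrite big1// mulr0.
- by move=> i _; exists [::]; split=> //; rewrite /weight big_nil.
move=> s _; exists [::]; split=> //.
by rewrite /weight big_nil addr0 state_cost_ge0.
Qed.

(** The new [gamma] is the old one permuted by [next]. The new [alpha] takes the cheaper of two
    phases, hence at most their average, and [window_le] bounds the sum of these averages. *)
Lemma affordable_edge v x t :
  hung v (Branch x t Empty) -> affordable x t ->
  affordable v (Branch x t Empty).
Proof.
move=> hx; have [vx _ _] := hx.
move=> [alpha [gamma [[al_ge0 ga_ge0 al0] _ sum_ga _ covB]]].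
set h := fheight t in al0 sum_ga covB.
pose beta s := state_cost h.+1 s + gamma (next s).
have cov_beta s : (s < 2 * a)%N -> covers (Branch x t Empty) (beta s)
    (state_pre v h.+1 s) (state_post v h.+1 s).
  by move=> lt_s; apply: covers_edge => //; apply: covB; exact: next_lt.
(* Phase [2 * a - i.+1] starts the first new ball just after the [i] covered vertices, phase [i]
   starts it [i] vertices before [v]. Once [i] reaches the height, nothing is left to cover. *)
pose alpha' i := if (i < h.+1)%N then Num.min (beta (2 * a - i.+1)%N) (beta i) else 0.
have beta_ge0 s : 0 <= beta s by rewrite addr_ge0// state_cost_ge0.
exists alpha', (gamma \o next); rewrite [fheight _]/= maxn0 -/h; split=> //=.
- split=> //.
    by move=> i; rewrite /alpha'; case: ifP => // _; rewrite le_min !beta_ge0.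
  by move=> i le_i; rewrite /alpha' ltnNge le_i.
- rewrite addn0.
  (* The inner sum has at most one term; it encodes the condition [i < minn a h.+1] in a form that
     can be exchanged into [window]. *)
  have le_alpha (i : 'I_a) : alpha' i <= 2^-1 *
      (\sum_(j < minn a h.+1 | j == i :> nat)
         (C (h.+1 - i)%N + C (h.+2 + i)%N) +
       (gamma (next (2 * a - i.+1)%N) + gamma (next i))).
    rewrite /alpha'; have [lt_i|le_i] := ltnP i h.+1; last first.
      by rewrite mulr_ge0 ?invr_ge0 ?addr_ge0 ?sumr_ge0// => j _;
        rewrite addr_ge0// /C /chain_cost addr_ge0// mulr_ge0.
    have lt_im : (i < minn a h.+1)%N by have := ltn_ord i; lia.
    rewrite (big_pred1 (Ordinal lt_im)); last by move=> j; rewrite /= -val_eqE.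
    have -> : C (h.+1 - i)%N = state_cost h.+1 (2 * a - i.+1).
      have e : ahead h.+1 (2 * a - i.+1) = i.
        by rewrite /ahead; have := ltn_ord i; lia.
      by rewrite /state_cost e ifF//; have := ltn_ord i; lia.
    have -> : C (h.+2 + i)%N = state_cost h.+1 i.
      rewrite /state_cost ifT ?(addnC i.+1) ?addSnnS ?addnS ?addSn//.
      by rewrite /ahead; have := ltn_ord i; lia.
    have := ge_min (beta i) (beta (2 * a - i.+1)%N) (beta i).
    have := ge_min (beta (2 * a - i.+1)%N) (beta (2 * a - i.+1)%N) (beta i).
    by rewrite !lexx orbT /= /beta; lra.
  apply: le_trans (ler_sum _ (fun i _ => le_alpha i)) _.
  rewrite -mulr_sumr big_split /= -(sum_fold (gamma \o next)) sum_next.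
  have -> : \sum_(i < a) \sum_(j < minn a h.+1 | j == i :> nat)
      (C (h.+1 - i)%N + C (h.+2 + i)%N) = window w a h.+1 (minn a h.+1).
    rewrite (exchange_big_dep xpredT)//=; apply: eq_bigr => j _.
    have lt_j : (j < a)%N by have := ltn_ord j; lia.
    by rewrite (big_pred1 (Ordinal lt_j))// => i; rewrite /= -val_eqE eq_sym.
  have := window_le a0 w0 w_last w_mean h.+1; rewrite -/kappa.
  have -> : (fsize t).+1%:R = h.+1%:R + (fsize t - h)%:R :> R.
    by rewrite -natrD; congr _%:R; have := fheight_size t; rewrite -/h; lia.
  by move: sum_ga; nra.
- rewrite sum_next addn0 subSS; exact: sum_ga.
- move=> i lt_i; rewrite /alpha'; have [lt_ih|le_hi] := ltnP i h.+1; last first.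
    exists [::]; split=> //; first by rewrite /weight big_nil.
    move=> l' _ vi; split=> // y /(hung_near hx)[n [le_n vy]].
    apply: grants_near vy _; apply: grants_le vi; rewrite addn0.
    by apply: leq_trans le_n _; rewrite /= maxn0.
  have case2 s c : (s < 2 * a)%N -> beta s <= c ->
      (forall l', grants l' v i -> state_pre v h.+1 s l') ->
      covers (Branch x t Empty) c (fun l => grants l v i) xpredT.
    move=> lt_s le_c pre; have [l [? ? ? cov]] := cov_beta s lt_s.
    exists l; split=> //; first exact: le_trans le_c.
    by move=> l' sub_l /pre pre'; have [] := cov l' sub_l pre'.
  rewrite minEle; case: ifP => _.
    apply: (case2 (2 * a - i.+1)%N) => //; first by lia.
    move=> l' vi; right; rewrite (_ : ahead _ _ = i)//.
    by rewrite /ahead; lia.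
  apply: (case2 i) => //; first by lia.
  by move=> l' _; left; rewrite /ahead; lia.
Qed.

(** Either part may contain the main path and grant at the root what the other part needs, hence the
    two orders. *)
Lemma covers_branch x s r c1 c2 (pre1 pre2 pre post1 post2 post : _ -> Prop) :
  covers (Branch x s Empty) c1 pre1 post1 -> covers r c2 pre2 post2 ->
  (forall l, pre l ->
    (pre1 l /\ (post1 l -> pre2 l)) \/ (pre2 l /\ (post2 l -> pre1 l))) ->
  (forall l, post1 l -> post2 l -> post l) ->
  covers (Branch x s r) (c1 + c2) pre post.
Proof.
move=> [l1 [sz1 ok1 le1 cov1]] [l2 [sz2 ok2 le2 cov2]] pre12 post12.
exists (l1 ++ l2); split.
- by move: sz1 => /=; rewrite size_cat; lia.
- by rewrite all_cat ok1.
- by rewrite weight_cat lerD.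
move=> l' sub_l pre'.
have sub1 : {subset l1 <= l'} by move=> b bl; apply: sub_l; rewrite mem_cat bl.
have sub2 : {subset l2 <= l'}.
  by move=> b bl; apply: sub_l; rewrite mem_cat bl orbT.
have cov y : (forall y, infor y (Branch x s Empty) -> grants l' y 0) ->
    (forall y, infor y r -> grants l' y 0) ->
    infor y (Branch x s r) -> grants l' y 0.
  move=> c1' c2' [->|ys|yr]; last exact: c2'.
    by apply: c1'; apply: Or31.
  by apply: c1'; apply: Or32.
have [[p1 p2]|[p2 p1]] := pre12 _ pre'.
  have [q1 c1'] := cov1 _ sub1 p1.
  have [q2 c2'] := cov2 _ sub2 (p2 q1).
  by split; [exact: post12|move=> y; exact: cov].
have [q2 c2'] := cov2 _ sub2 p2.
have [q1 c1'] := cov1 _ sub1 (p1 q2).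
by split; [exact: post12|move=> y; exact: cov].
Qed.

(** The taller part carries the main path; the other is covered from the residual radius at [v]. Its
    [alpha] vanishes at the height of the taller part, as [sum_residual] requires. *)
Lemma affordable_branch v x s r :
  affordable v (Branch x s Empty) -> affordable v r ->
  affordable v (Branch x s r).
Proof.
move=> [al1 [ga1 [[al1_ge0 ga1_ge0 al1_0] sum_al1 sum_ga1 covA1 covB1]]].
move=> [al2 [ga2 [[al2_ge0 ga2_ge0 al2_0] sum_al2 sum_ga2 covA2 covB2]]].
set t1 := Branch x s Empty in al1_0 sum_al1 sum_ga1 covA1 covB1.
have k0 := kappa_ge0.
have sz : fsize (Branch x s r) = (fsize t1 + fsize r)%N by rewrite /=; lia.
have ht : fheight (Branch x s r) = maxn (fheight t1) (fheight r).
  by rewrite /=; lia.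
have h1 : (0 < fheight t1)%N by rewrite /=; lia.
have le1 := fheight_size t1; have le2 := fheight_size r.
pose main := (fheight r <= fheight t1)%N.
pose h := fheight (Branch x s r).
exists (fun i => al1 i + al2 i), (fun q => if main
  then ga1 q + al2 (residual h q) else ga2 q + al1 (residual h q)); split.
- split.
  + by move=> i; rewrite addr_ge0.
  + by move=> q; case: ifP => _; rewrite addr_ge0.
  by move=> i le_i; rewrite al1_0 ?al2_0 ?addr0 //; move: le_i; rewrite ht; lia.
- by rewrite big_split sz natrD mulrDr lerD.
- rewrite sz /h ht /main; case: (leqP (fheight r) (fheight t1)) => hr.
    have := sum_residual al2_ge0 (al2_0 _ hr).
    rewrite big_split -addnBAC// natrD /=; move: sum_ga1 sum_al2; rewrite /=; lra.
  have := sum_residual al1_ge0 (al1_0 _ (ltnW hr)).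
  rewrite big_split -addnBA// natrD /=; move: sum_ga2 sum_al1; rewrite /=; lra.
- move=> i lt_i; apply: covers_branch (covA1 i lt_i) (covA2 i lt_i) _ _ => //.
  by move=> l vi; left.
move=> q lt_q; rewrite -/h /main; have lt_res := residual_lt h lt_q.
have res_pre v' l : state_pre v' h q l -> state_post v' h q l ->
    grants l v' (residual h q).
  rewrite /state_pre /state_post /residual.
  case: (ltnP q (ahead h q)) => [lt_qe _ /(_ isT) g|le_eq [//|g _]].
    by apply: grants_le g; lia.
  by apply: grants_le g; lia.
case: ifP => hr.
  have eh : h = fheight t1 by rewrite /h ht; lia.
  rewrite addrA; rewrite eh in lt_res res_pre *.
  apply: covers_branch (covB1 q lt_q) (covA2 _ lt_res) _ _ => // l pre.
  by left; split=> // post; exact: res_pre.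
have eh : h = fheight r by rewrite /h ht; lia.
rewrite addrA addrC; rewrite eh in lt_res res_pre *.
apply: covers_branch (covA1 _ lt_res) (covB2 q lt_q) _ _ => // l pre.
by right; split=> // post; exact: res_pre.
Qed.

Lemma hung_affordable v t : hung v t -> affordable v t.
Proof.
elim: t v => [|x s IHs r IHr] v; first by move=> _; exact: affordable_empty.
move=> [vx hs hr]; apply: affordable_branch; last exact: IHr.
by apply: affordable_edge; [split|exact: IHs].
Qed.

(** A ball of radius [a] at the root grants every [i < a], and some [alpha i] is at most the
    average. *)
Lemma cover_rooted v t : hung v t ->
  exists l, [/\ (size l <= (fsize t).+1)%N, all (fun b => 0 < b.2 <= a)%N l,
    weight l <= kappa / a%:R * (fsize t)%:R + w a &
    grants l v 0 /\ forall y, infor y t -> grants l y 0].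
Proof.
move=> /hung_affordable[alpha [_ [[_ _ _] sum_al _ covA _]]].
have aR : (0 : R) < a%:R by rewrite ltr0n.
have [i le_i] : exists i : 'I_a, alpha i <= kappa / a%:R * (fsize t)%:R.
  apply: contrapT => no; suff : kappa * (fsize t)%:R < kappa * (fsize t)%:R.
    by rewrite ltxx.
  apply: lt_le_trans sum_al.
  have -> : kappa * (fsize t)%:R =
      \sum_(i < a) (kappa / a%:R * (fsize t)%:R).
    by rewrite sumr_const card_ord -mulr_natr; field; rewrite gt_eqF.
  apply: ltr_sum; first by apply/hasP; exists (Ordinal a0); rewrite ?mem_index_enum.
  by move=> i _; rewrite ltNge; apply/negP => le_i; apply: no; exists i.
have [l [sz_l ok_l le_l cov]] := covA i (ltn_ord i).
have va : grants ((v, a) :: l) v a by apply: grants_in; rewrite mem_head.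
exists ((v, a) :: l); split=> /=.
- by [].
- by rewrite a0 leqnn.
- rewrite /weight big_cons /= -/(weight l) addrC lerD2r.
  exact: le_trans le_l le_i.
have [] := cov ((v, a) :: l).
- by move=> b bl; rewrite inE bl orbT.
- by apply: grants_le va; have := ltn_ord i; lia.
by move=> _ cov'; split=> //; exact: grants_le va.
Qed.

End ForestCover.

(** * Reduction to nondecreasing weights *)

Section MonotoneHull.
Variable R : realFieldType.

(** For [0 < r <= q], [w' r] is the minimum of [w] over the radii from [r] to [q]: the price of a
    ball of radius [r] when a larger one may be used instead. *)
Lemma monotone_hull (w : nat -> R) q : (forall j, 0 <= w j) ->
  exists w' : nat -> R,
  [/\ w' 0 = 0, forall j, 0 <= w' j, forall j, (0 < j <= q)%N -> w' j <= w j,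
    forall i j, (0 < i <= j)%N -> (j <= q)%N -> w' i <= w' j &
    forall r, (0 < r <= q)%N -> exists2 j, (r <= j <= q)%N & w' r = w j].
Proof.
move=> w_ge0; elim: q => [|q [w' [w'0 w'_ge0 w'_le w'_mono w'_att]]].
  by exists (fun=> 0); split=> // i; lia.
exists (fun j => if (j <= q)%N then Num.min (w' j) (w q.+1) else w q.+1).
split.
- by rewrite w'0 min_l.
- by move=> j; case: ifP => // _; rewrite le_min w'_ge0 /=.
- move=> j hj; case: leqP => lt_j; last by rewrite (_ : j = q.+1)//; lia.
  by rewrite ge_min w'_le//; lia.
- move=> i j hij le_j; case: (leqP j q) => lt_j.
    rewrite ifT; last by lia.
    by rewrite le_min !ge_min w'_mono// lexx orbT.
  by case: ifP => // _; rewrite ge_min lexx orbT.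
move=> r hr; case: leqP => lt_r; last by exists q.+1 => //; lia.
rewrite /Num.min; case: ifP => _; last by exists q.+1 => //; lia.
have [|j hj ->] := w'_att r; first by lia.
by exists j => //; lia.
Qed.

End MonotoneHull.

(** * Choice of the radius and cover of a single piece *)

Section PieceCover.
Variables (R : realFieldType) (X : eqType) (near : nat -> X -> X -> Prop).
Hypotheses (near0 : forall x, near 0 x x)
  (near_sym : forall n x y, near n x y -> near n y x)
  (near_trans : forall m n x y z, near m x y -> near n y z -> near (m + n) x z).
Variables (q : nat) (q0 : (0 < q)%N).

(** Take [a] minimising [cumul w a / a%:R ^+ 2]; comparison with [a - 1] bounds [w a]. *)
Lemma exists_scale (w : nat -> R) : (forall j, 0 <= w j) ->
  exists a, [/\ (0 < a <= q)%N, w a * a%:R <= 2 * cumul w a &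
    cumul w a / a%:R ^+ 2 <= cumul w q / q%:R ^+ 2].
Proof.
move=> w_ge0; pose f (i : 'I_q) : R := cumul w i.+1 / i.+1%:R ^+ 2.
have [i _ min_i] := @Order.TotalTheory.arg_minP _ _ _ (Ordinal q0) xpredT f isT.
have lt_i := ltn_ord i; exists i.+1; split=> //.
  have c_ge0 : 0 <= cumul w i by apply: sumr_ge0.
  have wi := w_ge0 i.+1.
  have iR : (0 : R) < i.+1%:R by [].
  rewrite -(ler_pM2l iR).
  have -> : cumul w i.+1 = cumul w i + w i.+1 by rewrite /cumul big_nat_recr.
  have [i0|i_gt0] := posnP i; first by move: wi; rewrite i0 {1}/cumul big_geq//; lra.
  have lt_p : (i.-1 < q)%N by lia.
  have := min_i (Ordinal lt_p) isT; rewrite /f /= prednK//.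
  have pR : (0 : R) < i%:R by rewrite ltr0n.
  rewrite ler_pdivrMr ?exprn_gt0// mulrAC ler_pdivlMr ?exprn_gt0//.
  have -> : cumul w i.+1 = cumul w i + w i.+1 by rewrite /cumul big_nat_recr.
  rewrite -natr1; set x := i%:R in pR *; set c := cumul w i in c_ge0 *.
  set z := w _ in wi *; nra.
have lt_q : (q.-1 < q)%N by lia.
by have := min_i (Ordinal lt_q) isT; rewrite /f /= prednK.
Qed.

Lemma cumul_mean (w : nat -> R) a : (forall j, 0 <= w j) ->
  (forall i j, (0 < i <= j)%N -> (j <= a)%N -> w i <= w j) ->
  forall l, (l <= a)%N -> cumul w l * a%:R <= l%:R * cumul w a.
Proof.
move=> w_ge0 w_mono l le_la; move: w_mono; rewrite -(subnKC le_la).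
elim: (a - l)%N => [|n IHn] w_mono; first by rewrite addn0 mulrC.
rewrite addnS -natr1 /cumul [X in _ <= _ * X]big_nat_recr //= -!/(cumul _ _).
rewrite !mulrDr mulr1; apply: lerD.
  by apply: IHn => i j hij le_j; apply: w_mono => //; lia.
have -> : l%:R * w (l + n).+1 = \sum_(1 <= j < l.+1) w (l + n).+1.
  by rewrite sumr_const_nat subn1 /= mulr_natl.
by apply: ler_sum_nat => j hj; apply: w_mono; lia.
Qed.

Lemma cumul_le (w w' : nat -> R) n :
  (forall j, (0 < j <= n)%N -> w' j <= w j) -> cumul w' n <= cumul w n.
Proof. by move=> le_w; apply: ler_sum_nat => j hj; apply: le_w; lia. Qed.

Lemma term_le_cumul (w : nat -> R) a :
  (forall j, 0 <= w j) -> (0 < a <= q)%N -> w a <= cumul w q.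
Proof.
move=> w_ge0 ha; rewrite /cumul (bigD1_seq a) ?iota_uniq//=.
  by rewrite lerDl sumr_ge0.
by rewrite mem_index_iota; lia.
Qed.

Lemma piece_cover (w : nat -> R) v t : (forall j, 0 <= w j) -> hung near v t ->
  exists l : seq (X * nat),
  [/\ (size l <= (fsize t).+1)%N, all (fun b => 0 < b.2 <= q)%N l,
    weight w l <= ((fsize t)%:R / q%:R ^+ 2 + 1) * cumul w q &
    grants near l v 0 /\ forall y, infor y t -> grants near l y 0].
Proof.
move=> w_ge0 ht; have [w' [w'0 w'_ge0 w'_le w'_mono w'_att]] := monotone_hull q w_ge0.
have [a [ha w'_last w'_min]] := exists_scale w'_ge0.
have a0 : (0 < a)%N by lia.
have w'_mean := cumul_mean w'_ge0 (fun i j h le_j =>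
  w'_mono i j h (leq_trans le_j (proj2 (andP ha)))).
have [l [sz_l ok_l le_l [vl cov]]] := cover_rooted near0 near_sym near_trans
  a0 w'0 w'_ge0 w'_last w'_mean ht.
(* [J r] is a radius at least [r] at which [w' r] is attained; replacing [r] by it preserves
   coverage. *)
have /choice[J hJ] : forall r, exists j,
    (0 < r <= q)%N -> (r <= j <= q)%N /\ w' r = w j.
  move=> r; have [hr|nhr] := boolP (0 < r <= q)%N; last by exists 0.
  by have [j ? ?] := w'_att r hr; exists j.
have ok_r b : b \in l -> (0 < b.2 <= q)%N.
  by move=> /(allP ok_l) /andP[-> le_b] /=; apply: leq_trans le_b _; lia.
have gr y n : grants near l y n -> grants near [seq (b.1, J b.2) | b <- l] y n.
  move=> [b [i [bl bi le_b]]]; exists (b.1, J b.2), i; split=> //=.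
    exact: map_f.
  have [/andP[le_J _] _] := hJ _ (ok_r _ bl); exact: leq_trans le_b le_J.
exists [seq (b.1, J b.2) | b <- l]; split.
- by rewrite size_map.
- apply/allP => _ /mapP[b bl ->] /=.
  have [/andP[le_J ->] _] := hJ _ (ok_r _ bl); rewrite andbT.
  by apply: leq_trans le_J; have /andP[] := ok_r _ bl.
- rewrite /weight big_map /= (_ : \sum_(b <- l) _ = weight w' l); last first.
    by apply: eq_big_seq => b /ok_r hb; have [_ ->] := hJ _ hb.
  have w'w : cumul w' q <= cumul w q := cumul_le w'_le.
  apply: le_trans le_l _; rewrite mulrDl mul1r; apply: lerD; last first.
    exact: le_trans (term_le_cumul w'_ge0 ha) w'w.
  rewrite -[leRHS]mulrA (_ : _ * _%:R = (fsize t)%:R * (cumul w' a / a%:R ^+ 2)).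
    rewrite ler_wpM2l//; apply: le_trans w'_min _.
    by rewrite mulrC ler_wpM2l// invr_ge0 exprn_ge0.
  by rewrite expr2 invfM; ring.
by split=> [|y /cov]; exact: gr.
Qed.

End PieceCover.

(** * Balancing the radii *)

HB.instance Definition _ (A : Type) := gen_eqMixin (forest A).

Section Balance.
Variables (R : realFieldType) (X : eqType) (near : nat -> X -> X -> Prop).
Hypotheses (near0 : forall x, near 0 x x)
  (near_sym : forall n x y, near n x y -> near n y x)
  (near_trans : forall m n x y z, near m x y -> near n y z -> near (m + n) x z).

(** Work upward from the leaves and cut off the remainder once its size reaches [S]. It consists of
    one vertex and two remainders below [S], so it stays below [2 * S]. *)
Lemma cut_forest S v t : (0 < S)%N -> hung near v t ->
  exists (t' : forest X) (ps : seq (X * forest X)),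
  [/\ (fsize t' < S)%N, hung near v t',
    forall p, p \in ps -> (S <= fsize p.2 < 2 * S)%N /\ hung near p.1 p.2,
    (\sum_(p <- ps) fsize p.2 + fsize t' = fsize t)%N &
    forall y, infor y t -> infor y t' \/ exists2 p, p \in ps & infor y p.2].
Proof.
move=> S0; elim: t v => [|x s IHs r IHr] v /=.
  by move=> _; exists Empty, [::]; split=> //; rewrite big_nil.
move=> [vx /IHs[s' [ps [lt_s hs ps_ok sz_s cov_s]]]].
move=> /IHr[r' [pr [lt_r hr pr_ok sz_r cov_r]]].
pose t' := Branch x s' r'.
have ht' : hung near v t' by split.
have ok p : p \in ps ++ pr ->
    (S <= fsize p.2 < 2 * S)%N /\ hung near p.1 p.2.
  by rewrite mem_cat => /orP[/ps_ok|/pr_ok].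
have sz : (\sum_(p <- ps ++ pr) fsize p.2 + fsize t' =
    (fsize s + fsize r).+1)%N by rewrite big_cat /=; lia.
have cov y : infor y (Branch x s r) ->
    infor y t' \/ exists2 p, p \in ps ++ pr & infor y p.2.
  move=> [->|/cov_s[ys|[p pp yp]]|/cov_r[yr|[p pp yp]]].
  - by left; apply: Or31.
  - by left; apply: Or32.
  - by right; exists p; rewrite ?mem_cat ?pp.
  - by left; apply: Or33.
  - by right; exists p; rewrite ?mem_cat ?pp ?orbT.
have [lt_t'|le_t'] := ltnP (fsize t') S; first by exists t', (ps ++ pr).
exists Empty, ((v, t') :: ps ++ pr); split=> //.
- move=> p; rewrite inE => /orP[/eqP->|/ok//]; split=> //=.
  by rewrite le_t' /=; lia.
- by rewrite big_cons addn0 addnC.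
move=> y /cov[yt'|[p pp yp]]; right; first by exists (v, t'); rewrite ?mem_head.
by exists p; rewrite // inE pp orbT.
Qed.

Definition usage (l : seq (X * nat)) (j : nat) : nat := count (fun b => b.2 == j) l.

Lemma weight_usage (w : nat -> R) q (l : seq (X * nat)) :
  all (fun b => 0 < b.2 <= q)%N l ->
  weight w l = \sum_(1 <= j < q.+1) w j * (usage l j)%:R.
Proof.
elim: l => [_|b l IHl /=/andP[hb /IHl wl]].
  by rewrite /weight big_nil big1// => j _; rewrite mulr0.
rewrite /weight big_cons -/(weight w l) wl /usage /=.
under [RHS]eq_bigr do rewrite natrD mulrDr.
rewrite big_split /=; congr (_ + _).
rewrite (bigD1_seq b.2) ?iota_uniq ?mem_index_iota//= eqxx mulr1 big1 ?addr0//.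
by move=> j; rewrite eq_sym => /negPf->; rewrite mulr0.
Qed.

Lemma pos_part_sqr (y z : R) : Num.max (y + z) 0 ^+ 2 <=
  Num.max y 0 ^+ 2 + 2 * (Num.max y 0 * z) + z ^+ 2.
Proof.
rewrite /Num.max; case: (ltP (y + z) 0) => h1; case: (ltP y 0) => h2; nra.
Qed.

Variables (q S : nat) (q0 : (0 < q)%N).

(** The allowance of each single radius: [piece_cover] costs this much per unit of total weight,
    summed over the pieces. *)
Definition quota (ps : seq (X * forest X)) : R :=
  \sum_(p <- ps) ((fsize p.2)%:R / q%:R ^+ 2 + 1).

(* Greedy balancing: the next piece is covered cheaply for the weights given by
   the current excesses, so that the sum of their squares grows only by the
   second order term. *)
Lemma balanced_cover (ps : seq (X * forest X)) :
  (forall p, p \in ps -> (fsize p.2 < 2 * S)%N /\ hung near p.1 p.2) ->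
  exists l : seq (X * nat), [/\ all (fun b => 0 < b.2 <= q)%N l,
    forall p, p \in ps -> grants near l p.1 0 /\
      forall y, infor y p.2 -> grants near l y 0 &
    \sum_(1 <= j < q.+1) Num.max ((usage l j)%:R - quota ps) 0 ^+ 2
      <= (size ps)%:R * q%:R * (2 * S).+1%:R ^+ 2].
Proof.
elim: ps => [_|p ps IHps ps_ok].
  exists [::]; split=> //; rewrite /quota big_nil big1 ?mulr0 ?mul0r//.
  by move=> j _; rewrite subr0 maxxx expr0n.
have [|l [ok_l cov_l le_l]] := IHps.
  by move=> p' pp'; apply: ps_ok; rewrite inE pp' orbT.
have [sz_p hp] := ps_ok p (mem_head _ _).
pose w j := Num.max ((usage l j)%:R - quota ps) 0.
have w_ge0 j : 0 <= w j by rewrite /w le_max lexx orbT.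
have [l1 [sz_l1 ok_l1 le_l1 cov_l1]] :=
  piece_cover near0 near_sym near_trans q0 w_ge0 hp.
exists (l1 ++ l); split.
- by rewrite all_cat ok_l1.
- have gr (l' : seq (X * nat)) y : {subset l' <= l1 ++ l} ->
      grants near l' y 0 -> grants near (l1 ++ l) y 0.
    by move=> sub [b [i [bl ? ?]]]; exists b, i; split=> //; apply: sub.
  have sub1 : {subset l1 <= l1 ++ l} by move=> b bl; rewrite mem_cat bl.
  have sub2 : {subset l <= l1 ++ l} by move=> b bl; rewrite mem_cat bl orbT.
  move=> p'; rewrite inE => /orP[/eqP->|/cov_l[g cov]].
    have [g cov] := cov_l1; split; first exact: (gr _ _ sub1 g).
    move=> y /cov. exact: (gr _ _ sub1).
  by split=> [|y /cov]; exact: (gr _ _ sub2).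
set s := (fsize p.2)%:R / q%:R ^+ 2 + 1 in le_l1.
have s_ge0 : 0 <= s by rewrite addr_ge0// divr_ge0// exprn_ge0.
have q2 : (1 : R) <= q%:R ^+ 2 by rewrite -natrX ler1n expn_gt0 q0.
have s_le : s <= (2 * S).+1%:R.
  rewrite -natr1 lerD2r ler_pdivrMr; last by apply: lt_le_trans q2.
  apply: (@le_trans _ _ (2 * S)%:R); first by rewrite ler_nat ltnW.
  by rewrite ler_peMr.
have step j : Num.max ((usage (l1 ++ l) j)%:R - quota (p :: ps)) 0 ^+ 2 <=
    w j ^+ 2 + 2 * (w j * (usage l1 j)%:R - s * w j) + (2 * S).+1%:R ^+ 2.
  rewrite /usage count_cat -!/(usage _ _) natrD /quota big_cons -/(quota ps).
  rewrite -/s (_ : _ - _ = ((usage l j)%:R - quota ps) + ((usage l1 j)%:R - s));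
    last by ring.
  apply: le_trans (pos_part_sqr _ _) _; rewrite -/(w j).
  have u_le : (usage l1 j)%:R <= (2 * S).+1%:R :> R.
    rewrite ler_nat; apply: leq_trans (count_size _ _) _.
    by apply: leq_trans sz_l1 _; rewrite ltnS ltnW.
  have u_ge0 : (0 : R) <= (usage l1 j)%:R by [].
  have : ((usage l1 j)%:R - s) ^+ 2 <= (2 * S).+1%:R ^+ 2.
    move: u_le u_ge0 s_le s_ge0; set u := (usage l1 j)%:R; set Z := _.+1%:R.
    nra.
  set z := (_ - _) ^+ 2; lra.
have sum_step := @ler_sum_nat _ 1 q.+1 _ _ (fun j _ => step j).
apply: le_trans sum_step _.
(* Summed over [j], the linear term is twice [weight w l1 - s * cumul w q], which [le_l1] makes
   nonpositive. *)
rewrite !big_split /= -mulr_sumr sumrB -mulr_sumr -weight_usage// -/(cumul w q).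
rewrite sumr_const_nat subn1 /= -natr1 -[_ *+ q]mulr_natl.
move: le_l le_l1; rewrite -/w; set Z := _.+1%:R ^+ 2.
set A := \sum_(_ <= _ < _) _; set B := weight w l1; set D := cumul w q.
nra.
Qed.

End Balance.

(** * Points of a metric tree *)

Section MetricTree.
Variables (R : realType) (T : metric_tree R).
Implicit Types (x y z : point T) (u v : vertex T).

Lemma adj_symm u v : adj u v -> adj v u.
Proof. by have [sym _ _ _ _] := treeP T; rewrite sym. Qed.

Definition walk u v (c : R) : Prop :=
  exists p, [/\ path (@adj R T) u p, last u p = v & walk_length u p = c].

Lemma walk_refl u : walk u u 0.
Proof. by exists [::]. Qed.

Lemma walk_edge u v : adj u v -> walk u v (len u v).
Proof. by move=> uv; exists [:: v]; rewrite /= uv addr0. Qed.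

Lemma walk_trans u v w c d : walk u v c -> walk v w d -> walk u w (c + d).
Proof.
move=> [p [hp lp <-]] [r [hr lr <-]]; exists (p ++ r); split.
- by rewrite cat_path hp lp.
- by rewrite last_cat lp.
elim: p u lp {hp} => [|a p IHp] u /= lp; first by rewrite add0r lp.
by rewrite IHp// addrA.
Qed.

Lemma walk_sym u v c : walk u v c -> walk v u c.
Proof.
move=> [p [hp <- <-]]; elim: p u hp => [|a p IHp] u /=.
  by move=> _; exact: walk_refl.
move=> /andP[ua hp]; rewrite addrC; apply: walk_trans (IHp _ hp) _.
by rewrite len_sym; apply: walk_edge; exact: adj_symm.
Qed.

Lemma walk_ge0 u v c : walk u v c -> 0 <= c.
Proof.
move=> [p [hp _ <-]]; elim: p u hp => //= a p IHp u /andP[ua hp].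
by rewrite addr_ge0 ?IHp// ltW// len_gt0.
Qed.

Lemma stub_ge0 x u a : stub x u a -> 0 <= a.
Proof.
case=> [//|v w t e /andP[ht _]|v w t e /andP[_ ht]]; first exact: ltW.
by rewrite subr_ge0 ltW.
Qed.

Lemma stub_vertex v u a : stub (VertexPt v) u a -> u = v /\ a = 0.
Proof. by move=> h; inversion h. Qed.

Lemma stub_inner u v t (e : oedge u v) (ht : 0 < t < len u v) w a :
  stub (InnerPt e ht) w a -> w = u /\ a = t \/ w = v /\ a = len u v - t.
Proof. by move=> h; inversion h; subst; [left|right]. Qed.

(** Replaces [dist x y <= d]: explicit paths give the triangle inequality by concatenation, with no
    infimum to attain. *)
Definition conn x y (d : R) : Prop := exists2 c, path_len x y c & c <= d.

Lemma conn_stub x y u v a b c d :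
  stub x u a -> walk u v c -> stub y v b -> a + c + b <= d -> conn x y d.
Proof.
move=> xu [p [hp lp <-]] yv le_d; rewrite -lp in yv.
by exists (a + walk_length u p + b) => //; exact: PathThrough.
Qed.

Lemma path_lenP x y c : path_len x y c ->
  (exists u v a b d, [/\ stub x u a, walk u v d, stub y v b & c = a + d + b]) \/
  (exists u v s t (e : oedge u v) (hs : 0 < s < len u v) (ht : 0 < t < len u v),
    [/\ x = InnerPt e hs, y = InnerPt e ht & c = `|s - t|]).
Proof.
case=> [u p a b xu hp yb|u v s t e hs ht -> ->].
  by left; exists u, (last u p), a, b, (walk_length u p); split=> //; exists p.
by right; exists u, v, s, t, e, hs, ht.
Qed.

Lemma conn_dist x y d : conn x y d -> dist x y <= d.
Proof.
move=> [c xy le_cd]; apply: le_trans le_cd; apply: ge_inf => //.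
exists 0 => l /path_lenP[[u [v [a [b [e [xu uv yv ->]]]]]]|].
  by rewrite !addr_ge0 ?(stub_ge0 xu) ?(stub_ge0 yv) ?(walk_ge0 uv).
by move=> [u [v [s [t [e [hs [ht [_ _ ->]]]]]]]].
Qed.

Lemma conn_le x y c d : c <= d -> conn x y c -> conn x y d.
Proof. by move=> le_cd [b ? le_b]; exists b => //; exact: le_trans le_b le_cd. Qed.

Lemma path_inside u v s t (e : oedge u v)
    (hs : 0 < s < len u v) (ht : 0 < t < len u v) :
  path_len (InnerPt e hs) (InnerPt e ht) `|s - t|.
Proof. by apply: (@PathInside _ _ _ _ u v s t e hs ht). Qed.

Lemma conn_refl x d : 0 <= d -> conn x x d.
Proof.
case: x => [v|u v t e ht] d0.
  by apply: conn_stub (StubVertex v) (walk_refl v) (StubVertex v) _; rewrite !addr0.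
by exists `|t - t|; [exact: path_inside|rewrite subrr normr0].
Qed.

Lemma conn_sym x y d : conn x y d -> conn y x d.
Proof.
move=> [c /path_lenP xy le_d].
case: xy le_d => [[u [v [a [b [e [xu /walk_sym vu yv ->]]]]]] le_d|].
  by apply: conn_stub yv vu xu _; lra.
move=> [u [v [s [t [e [hs [ht [-> -> ->]]]]]]]] le_d.
by exists `|t - s|; [exact: path_inside|rewrite distrC].
Qed.

(** Joins two paths at [z]: if they leave its edge by different ends, the walk between these is no
    longer than the two stubs. *)
Lemma stub_walk z u v a b : stub z u a -> stub z v b ->
  exists2 c, walk u v c & c <= a + b.
Proof.
case: z => [w /stub_vertex[-> ->] /stub_vertex[-> ->]|w1 w2 t e ht].
  by exists 0; [exact: walk_refl|rewrite addr0].
have w12 : adj w1 w2 by case/andP: e.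
have ? := ltW (proj1 (andP ht)); have ? := ltW (proj2 (andP ht)).
move=> /stub_inner[] [-> ->] /stub_inner[] [-> ->].
- by exists 0; [exact: walk_refl|lra].
- by exists (len w1 w2); [exact: walk_edge|lra].
- by exists (len w1 w2); [exact/walk_sym/walk_edge|lra].
by exists 0; [exact: walk_refl|lra].
Qed.

Lemma stub_slide u v s t (e : oedge u v) (hs : 0 < s < len u v)
    (ht : 0 < t < len u v) w a : stub (InnerPt e ht) w a ->
  exists2 b, stub (InnerPt e hs) w b & b <= `|s - t| + a.
Proof.
have h1 := ler_norm (s - t); have h2 := ler_norm (t - s); rewrite distrC in h2.
move=> /stub_inner[] [-> ->].
  by exists s; [exact: StubLeft|lra].
by exists (len u v - s); [exact: StubRight|lra].
Qed.

Lemma InnerPt_inj u v t (e : oedge u v) (ht : 0 < t < len u v)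
    u' v' t' (e' : oedge u' v') (ht' : 0 < t' < len u' v') :
  InnerPt e ht = InnerPt e' ht' -> [/\ u = u', v = v' & t = t'].
Proof. by case. Qed.

Lemma conn_trans x y z c d : conn x y c -> conn y z d -> conn x z (c + d).
Proof.
move=> [c' xy le_c] [d' yz le_d]; apply: (@conn_le _ _ (c' + d')).
  exact: lerD.
case/path_lenP: xy => [[u [v [a [b [k [xu uv yv ->]]]]]]|];
    case/path_lenP: yz => [[u' [v' [a' [b' [k' [yu' uv' zv' ->]]]]]]|].
- have [l vu' le_l] := stub_walk yv yu'.
  apply: conn_stub xu (walk_trans (walk_trans uv vu') uv') zv' _; lra.
- move=> [w1 [w2 [s [t [e [hs [ht [ey -> ->]]]]]]]].
  rewrite ey in yv; have [l zl le_l] := stub_slide ht yv.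
  by apply: conn_stub xu uv zl _; move: le_l; rewrite distrC; lra.
- move=> [w1 [w2 [s [t [e [hs [ht [-> ey ->]]]]]]]].
  rewrite ey in yu'; have [l xl le_l] := stub_slide hs yu'.
  by apply: conn_stub xl uv' zv' _; lra.
move=> [w1 [w2 [s [t [e [hs [ht [-> -> ->]]]]]]]].
move=> [w3 [w4 [s' [t' [e' [hs' [ht' [-> ey ->]]]]]]]].
have [? ? ?] := InnerPt_inj ey; subst w3 w4 t'.
rewrite (bool_irrelevance e' e); exists `|s' - t|; first exact: path_inside.
by rewrite (_ : s' - t = (s' - s) + (s - t)) ?ler_normD//; ring.
Qed.

(* x is the point of the edge uv at distance t from u. *)
Definition onedge u v (t : R) x : Prop :=
  [\/ t = 0 /\ x = VertexPt u, t = len u v /\ x = VertexPt v,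
      exists s (e : oedge u v) (hs : 0 < s < len u v), s = t /\ x = InnerPt e hs
    | exists s (e : oedge v u) (hs : 0 < s < len v u),
        s = len u v - t /\ x = InnerPt e hs].

Lemma adj_oedge u v : adj u v -> oedge u v \/ oedge v u.
Proof.
move=> uv; rewrite /oedge uv adj_symm//=.
case: (ltngtP (enum_rank u) (enum_rank v)) => [| |/ord_inj/enum_rank_inj uv'];
  [by left|by right|].
by have [_ irr _ _ _] := treeP T; move: uv; rewrite uv' irr.
Qed.

Lemma onedge_ex u v t : adj u v -> 0 <= t <= len u v -> exists x, onedge u v t x.
Proof.
move=> uv /andP[]; rewrite le_eqVlt => /orP[/eqP<- _|t0].
  by exists (VertexPt u); apply: Or41.
rewrite le_eqVlt => /orP[/eqP->|tl]; first by exists (VertexPt v); apply: Or42.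
case: (adj_oedge uv) => e.
  have ht : 0 < t < len u v by rewrite t0.
  by exists (InnerPt e ht); apply: Or43; exists t, e, ht.
have ht : 0 < len u v - t < len v u.
  by rewrite [len v u]len_sym subr_gt0 tl /= ltrBlDr ltrDl.
by exists (InnerPt e ht); apply: Or44; exists (len u v - t), e, ht.
Qed.

Lemma onedge_vertices u v t x : adj u v -> 0 <= t <= len u v -> onedge u v t x ->
  conn (VertexPt u) x t /\ conn (VertexPt v) x (len u v - t).
Proof.
move=> uv /andP[t0 tl].
have edge a b : adj a b -> conn (VertexPt a) (VertexPt b) (len a b).
  move=> ab; apply: conn_stub (StubVertex a) (walk_edge ab) (StubVertex b) _.
  by rewrite addr0 add0r.
have inner w s a : stub w a s -> conn (VertexPt a) w s.
  move=> wa; apply: conn_stub (StubVertex a) (walk_refl a) wa _.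
  by rewrite !add0r.
case=> [[-> ->]|[-> ->]|[s [e [hs [<- ->]]]]|[s [e [hs [es ->]]]]].
- rewrite subr0; split; first exact: conn_refl.
  by rewrite len_sym; apply: edge; exact: adj_symm.
- by rewrite subrr; split; [exact: edge|exact: conn_refl].
- by split; apply: inner; [exact: StubLeft|exact: StubRight].
split; apply: inner; last by rewrite -es; exact: StubLeft.
rewrite (_ : t = len v u - s); first exact: StubRight.
by rewrite es [len v u]len_sym; ring.
Qed.

Lemma oedge_asym u v : oedge u v -> oedge v u -> False.
Proof. by move=> /andP[_ h1] /andP[_ h2]; move: (ltn_trans h1 h2); rewrite ltnn. Qed.

Lemma onedge_conn u v s t x y : adj u v ->
  0 <= s <= len u v -> 0 <= t <= len u v ->
  onedge u v s x -> onedge u v t y -> conn x y `|s - t|.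
Proof.
move=> uv hs ht ox oy.
have [ux vx] := onedge_vertices uv hs ox; have [uy vy] := onedge_vertices uv ht oy.
have /andP[s0 sl] := hs; have /andP[t0 tl] := ht.
have [[-> ->]|[-> ->]|[s' [e [hs' [es ex]]]]|[s' [e [hs' [es ex]]]]] := ox.
- by rewrite sub0r normrN ger0_norm.
- by rewrite ger0_norm// subr_ge0.
- have [[-> ->]|[-> ->]|[t' [e' [ht' [et ->]]]]|[t' [e' [ht' [et ->]]]]] := oy.
  + by rewrite subr0 ger0_norm//; apply: conn_sym.
  + by rewrite distrC ger0_norm ?subr_ge0//; apply: conn_sym.
  + rewrite ex (bool_irrelevance e' e) -es -et.
    by exists `|s' - t'|; first exact: path_inside.
  + by case: (oedge_asym e e').
have [[-> ->]|[-> ->]|[t' [e' [ht' [et ->]]]]|[t' [e' [ht' [et ->]]]]] := oy.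
- by rewrite subr0 ger0_norm//; apply: conn_sym.
- by rewrite distrC ger0_norm ?subr_ge0//; apply: conn_sym.
- by case: (oedge_asym e e').
rewrite ex (bool_irrelevance e' e); exists `|s' - t'|; first exact: path_inside.
by rewrite es et (_ : _ - _ - _ = t - s) 1?distrC//; ring.
Qed.

End MetricTree.

(** * Discretisation *)

Fixpoint fapp (A : Type) (s t : forest A) : forest A :=
  if s is Branch x s1 s2 then Branch x s1 (fapp s2 t) else t.

Lemma fsize_fapp (A : Type) (s t : forest A) : fsize (fapp s t) = (fsize s + fsize t)%N.
Proof. by elim: s => //= x s1 _ s2 ->; lia. Qed.

Lemma infor_fapp (A : Type) (s t : forest A) y :
  infor y s \/ infor y t -> infor y (fapp s t).
Proof.
elim: s => [[]//|x s1 _ s2 IHs /= [[->|ys|ys]|yt]].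
- exact: Or31.
- exact: Or32.
- by apply: Or33; apply: IHs; left.
by apply: Or33; apply: IHs; right.
Qed.

HB.instance Definition _ (R : realType) (T : metric_tree R) := gen_eqMixin (point T).

Section Discretization.
Variables (R : realType) (T : metric_tree R) (g : R).
Hypothesis g0 : 0 < g.
Implicit Types (x y z p : point T) (u v : vertex T) (F : forest (point T)).

Definition near_grid (n : nat) x y : Prop := conn x y (n%:R * g).

(** Like [hung], but the roots lie within a real distance [eta] of [p] instead of one full mesh. *)
Fixpoint rooted (p : point T) (eta : R) F : Prop :=
  if F is Branch x s r
  then [/\ conn p x eta, hung near_grid x s & rooted p eta r] else True.

Lemma rooted_hung p eta F : eta <= g -> rooted p eta F -> hung near_grid p F.
Proof.
move=> le_g; elim: F => //= x s _ r IHr [px hs /IHr hr]; split=> //.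
by apply: conn_le px; rewrite mul1r.
Qed.

Lemma rooted_conn p p' d eta F :
  conn p' p d -> rooted p eta F -> rooted p' (d + eta) F.
Proof.
by move=> pp'; elim: F => //= x s _ r IHr [px hs /IHr hr]; split=> //;
  exact: conn_trans pp' px.
Qed.

Lemma rooted_le p eta eta' F : eta <= eta' -> rooted p eta F -> rooted p eta' F.
Proof.
move=> le_e; elim: F => //= x s _ r IHr [px hs /IHr hr]; split=> //.
exact: conn_le px.
Qed.

Lemma rooted_fapp p eta F1 F2 :
  rooted p eta F1 -> rooted p eta F2 -> rooted p eta (fapp F1 F2).
Proof. by elim: F1 => //= x s _ r IHr [px hs /IHr hr] /hr; split. Qed.

(* The points of P either are within eta of p or are already within g of a grid
   point of F; each grid point is charged a length g, and p a length eta. *)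
Definition netted (p : point T) (L : R) (P : point T -> Prop) F (eta : R) :=
  [/\ 0 <= eta < g, g * (fsize F)%:R + eta <= L, rooted p eta F &
      forall y, P y -> conn p y eta \/ exists2 x, infor x F & conn x y g].

Lemma netted_move p p' d L P F eta : 0 <= d -> d + eta < g -> conn p' p d ->
  netted p L P F eta -> netted p' (L + d) P F (d + eta).
Proof.
move=> d0 lt_g pp' [/andP[e0 _] le_L rF cov]; split.
- by rewrite lt_g addr_ge0.
- by lra.
- exact: rooted_conn rF.
move=> y /cov[py|]; last by right.
by left; apply: conn_trans pp' py.
Qed.

(** Both leftovers are balls around [p], so the larger radius serves for both. *)
Lemma netted_join p L1 L2 P1 P2 F1 F2 e1 e2 :
  netted p L1 P1 F1 e1 -> netted p L2 P2 F2 e2 ->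
  netted p (L1 + L2) (fun y => P1 y \/ P2 y) (fapp F1 F2) (Num.max e1 e2).
Proof.
move=> [/andP[e10 e1g] le1 r1 cov1] [/andP[e20 e2g] le2 r2 cov2].
have m1 : e1 <= Num.max e1 e2 by rewrite le_max lexx.
have m2 : e2 <= Num.max e1 e2 by rewrite le_max lexx orbT.
split.
- by rewrite le_max e10 gt_max e1g.
- have : Num.max e1 e2 <= e1 + e2 by rewrite ge_max; lra.
  by rewrite fsize_fapp natrD mulrDr; lra.
- by apply: rooted_fapp; [apply: rooted_le r1|apply: rooted_le r2].
move=> y [/cov1[h|[x ? ?]]|/cov2[h|[x ? ?]]].
- by left; apply: conn_le h.
- by right; exists x => //; apply: infor_fapp; left.
- by left; apply: conn_le h.
by right; exists x => //; apply: infor_fapp; right.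
Qed.

Fixpoint tree_adj (u : vertex T) (f : forest (vertex T)) : Prop :=
  if f is Branch v s r then [/\ adj u v, tree_adj v s & tree_adj u r] else True.

Fixpoint tree_len (u : vertex T) (f : forest (vertex T)) : R :=
  if f is Branch v s r then len u v + tree_len v s + tree_len u r else 0.

Definition segment u v (t : R) y : Prop :=
  exists2 s, t <= s <= len u v & onedge u v s y.

Fixpoint on_tree (u : vertex T) (f : forest (vertex T)) y : Prop :=
  if f is Branch v s r
  then [\/ segment u v 0 y, on_tree v s y | on_tree u r y] else False.

(** Moving towards [u] enlarges the leftover radius; if it would reach [g], one grid point is placed
    where it equals [g]. *)
Lemma netted_step u v L P (t t1 : R) x x1 F eta : adj u v ->
  0 <= t <= t1 -> t1 <= len u v -> t1 - t <= g ->
  onedge u v t x -> onedge u v t1 x1 ->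
  netted x1 L (fun y => segment u v t1 y \/ P y) F eta ->
  exists F' eta',
    netted x (L + (t1 - t)) (fun y => segment u v t y \/ P y) F' eta'.
Proof.
move=> uv /andP[t0 le_t] le_t1 le_g ox ox1 net.
have [/andP[e0 eg] le_L rF cov] := net.
have conn_at s s' y y' : t <= s <= len u v -> t <= s' <= len u v ->
    onedge u v s y -> onedge u v s' y' -> conn y y' `|s - s'|.
  by move=> hs hs' oy oy'; apply: (onedge_conn uv _ _ oy oy'); lra.
have xx1 : conn x x1 (t1 - t).
  by rewrite -[_ - _]ger0_norm ?subr_ge0// distrC; apply: conn_at => //; lra.
have [lt_eg|le_ge] := ltP (t1 - t + eta) g.
  exists F, (t1 - t + eta).
  have t10 : 0 <= t1 - t by lra.
  have [? ? ? cov'] := netted_move t10 lt_eg xx1 net.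
  split=> // y [[s hs oy]|Py]; last by apply: cov'; right.
  have [le_s|lt_s] := leP t1 s; first by apply: cov'; left; exists s => //; lra.
  left; apply: (@conn_le _ _ _ _ `|t - s|); last by apply: conn_at => //; lra.
  by rewrite distrC ger0_norm; lra.
(* All points within [eta] of [x1] are within [g] of this point, and the new leftover [t2 - t] is at
   most [eta]. *)
pose t2 := t1 - (g - eta).
have ht2 : t <= t2 <= len u v by rewrite /t2; lra.
have [z oz] : exists z, onedge u v t2 z by apply: onedge_ex => //; lra.
have zx1 : conn z x1 (g - eta).
  rewrite (_ : g - eta = `|t2 - t1|).
    by apply: conn_at => //; lra.
  by rewrite distrC ger0_norm /t2; lra.
have xz : conn x z (t2 - t).
  rewrite -[_ - _]ger0_norm; last by lra.
  by rewrite distrC; apply: conn_at => //; lra.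
exists (Branch z F Empty), (t2 - t); split.
- by rewrite /t2; lra.
- by rewrite /= addn0 -natr1 mulrDr mulr1 /t2; lra.
- split=> //; apply: (@rooted_hung _ g) => //.
  by apply: rooted_le (rooted_conn zx1 rF); rewrite subrK.
have covz y : (segment u v t1 y \/ P y) ->
    exists2 x0, infor x0 (Branch z F Empty) & conn x0 y g.
  move=> /cov[h|[x0 ? ?]]; last by exists x0 => //; apply: Or32.
  exists z; first exact: Or31.
  by apply: conn_le (conn_trans zx1 h); rewrite subrK.
move=> y [[s hs oy]|Py]; last by right; apply: covz; right.
have [le_s|lt_s] := leP t1 s.
  by right; apply: covz; left; exists s => //; lra.
have [le_s2|lt_s2] := leP t2 s.
  right; exists z; first exact: Or31.
  apply: (@conn_le _ _ _ _ `|t2 - s|); last exact: conn_at.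
  by rewrite distrC ger0_norm /t2; move: lt_s le_s2; rewrite /t2; lra.
left; apply: (@conn_le _ _ _ _ `|t - s|); last by apply: conn_at => //; lra.
by rewrite distrC ger0_norm; lra.
Qed.

Lemma netted_edge u v P L F eta : adj u v ->
  netted (VertexPt v) L P F eta ->
  exists F' eta', netted (VertexPt u) (len u v + L)
    (fun y => segment u v 0 y \/ P y) F' eta'.
Proof.
move=> uv net; have luv := len_gt0 uv.
(* The edge is traversed from [v] in steps of length at most [g]; [n] bounds the number of steps to
   the point at distance [t] from [u]. *)
suff along n : forall t, 0 <= t <= len u v -> len u v - t <= n%:R * g ->
    forall x, onedge u v t x -> exists F' eta', netted x (L + (len u v - t))
      (fun y => segment u v t y \/ P y) F' eta'.
  have [|||F' [eta' net']] := along (Num.bound (len u v / g)) 0 _ _ (VertexPt u).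
  - by rewrite lexx ltW.
  - by rewrite subr0 -ler_pdivrMr// ltW// archi_boundP// divr_ge0// ltW.
  - exact: Or41.
  by exists F', eta'; rewrite addrC -[len u v]subr0.
elim: n => [|n IHn] t ht; rewrite ?mul0r => le_n x ox.
  have et : t = len u v by lra.
  have ov : onedge u v (len u v) (VertexPt v) by apply: Or42.
  have xv : conn x (VertexPt v) 0.
    rewrite -(normr0 R) -(subrr t) {2}et.
    by apply: (onedge_conn uv _ _ ox ov) => //; lra.
  have [/andP[e0 eg] _ _ _] := net.
  have [|? ? ? cov] := netted_move (lexx 0) _ xv net; first by rewrite add0r.
  exists F, (0 + eta); rewrite et subrr; split=> // y [[s hs oy]|/cov//].
  left; rewrite add0r; apply: conn_le e0 _.
  have -> : 0 = `|t - s| by rewrite (_ : t - s = 0) ?normr0//; lra.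
  by apply: (onedge_conn uv _ _ ox oy); lra.
pose t1 := Num.min (len u v) (t + g).
have t1_le : t1 <= len u v by rewrite /t1 ge_min lexx.
have t1_leg : t1 <= t + g by rewrite /t1 ge_min lexx orbT.
have t_le : t <= t1 by rewrite /t1 le_min lerDl (ltW g0) andbT; case/andP: ht.
have [x1 ox1] : exists x1, onedge u v t1 x1 by apply: onedge_ex => //; lra.
have [||F1 [e1 net1]] := IHn t1 _ _ x1 ox1; first by lra.
  have : 0 <= n%:R * g by rewrite mulr_ge0// ltW.
  rewrite /t1 minEle; case: ifP => _; first by lra.
  by move: le_n; rewrite -natr1; lra.
have ht1 : 0 <= t <= t1 by rewrite t_le andbT; case/andP: ht.
have le_g : t1 - t <= g by rewrite lerBlDl.
have [F' [e' net']] := netted_step uv ht1 t1_le le_g ox ox1 net1.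
exists F', e'; move: net'.
by rewrite (_ : L + _ + _ = L + (len u v - t))//; ring.
Qed.

Lemma netted_tree u f : tree_adj u f ->
  exists F eta, netted (VertexPt u) (tree_len u f) (on_tree u f) F eta.
Proof.
elim: f u => [|v s IHs r IHr] u /=.
  by move=> _; exists Empty, 0; split=> //=; rewrite ?lexx ?mulr0 ?addr0.
move=> [uv /IHs[F1 [e1 net1]] /IHr[F2 [e2 net2]]].
have [F3 [e3 net3]] := netted_edge uv net1.
have [? ? ? cov] := netted_join net3 net2.
exists (fapp F3 F2), (Num.max e3 e2); split=> // y [h|h|h]; apply: cov.
- by left; left.
- by left; right.
by right.
Qed.

End Discretization.

(** * Unfolding the graph into a rooted forest *)

Section SpanningForest.
Variables (R : realType) (T : metric_tree R).
Notation V := (vertex T).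
Implicit Types (u v w : V) (f : forest V).

(** Gives an edge the orientation under which [total_length] counts it. *)
Definition orient (e : V * V) : V * V := if oedge e.1 e.2 then e else (e.2, e.1).

Fixpoint tree_edges u f : seq (V * V) :=
  if f is Branch v s r then (u, v) :: tree_edges v s ++ tree_edges u r else [::].

Lemma tree_edges_ends u f a b : (a, b) \in tree_edges u f ->
  (a = u \/ infor a f) /\ infor b f.
Proof.
elim: f u => //= v s IHs r IHr u.
rewrite inE mem_cat => /or3P[/eqP[-> ->]|/IHs[[->|ha] hb]|/IHr[[->|ha] hb]].
- by split; [left|apply: Or31].
- by split; [right; apply: Or31|apply: Or32].
- by split; [right; apply: Or32|apply: Or32].
- by split; [left|apply: Or33].
by split; [right; apply: Or33|apply: Or33].
Qed.

Lemma insert_edge u f a b : adj a b -> tree_adj u f -> a = u \/ infor a f ->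
  exists f', tree_adj u f' /\
    perm_eq (tree_edges u f') ((a, b) :: tree_edges u f).
Proof.
move=> ab; elim: f u => [|v s IHs r IHr] u.
  by move=> _ [eu|[]]; subst u; exists (Branch b Empty Empty).
have at_sub : a = v \/ infor a s -> tree_adj u (Branch v s r) ->
    exists f', tree_adj u f' /\
    perm_eq (tree_edges u f') ((a, b) :: tree_edges u (Branch v s r)).
  move=> ha [uv hs hr]; have [s' [hs' perm_s]] := IHs v hs ha.
  exists (Branch v s' r); split=> //=.
  apply/permP => q; have /permP/(_ q) := perm_s.
  by rewrite /= !count_cat /=; lia.
move=> h [eu|[ha|ha|ha]].
- by subst u; exists (Branch b Empty (Branch v s r)).
- by apply: at_sub => //; left.
- by apply: at_sub => //; right.
have [uv hs hr] := h; have [r' [hr' perm_r]] := IHr u hr (or_intror ha).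
exists (Branch v s r'); split=> //=.
apply/permP => q; have /permP/(_ q) := perm_r.
by rewrite /= !count_cat /=; lia.
Qed.

Lemma orient_oedge a b : adj a b -> oedge (orient (a, b)).1 (orient (a, b)).2.
Proof.
by move=> ab; rewrite /orient /=; case: ifP => // nab; case: (adj_oedge ab); rewrite ?nab.
Qed.

Lemma tree_edges_adj u f e : tree_adj u f -> e \in tree_edges u f -> adj e.1 e.2.
Proof.
elim: f u => //= v s IHs r IHr u [uv hs hr].
by rewrite inE mem_cat => /or3P[/eqP->|/(IHs _ hs)|/(IHr _ hr)].
Qed.

(** If no edge at a vertex of the forest is new, these vertices are closed under adjacency, so by
    connectedness they are all vertices. *)
Lemma new_edge u f : tree_adj u f ->
  (exists a b, [/\ adj a b, a = u \/ infor a f &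
    orient (a, b) \notin [seq orient e | e <- tree_edges u f]]) \/
  (forall a b, adj a b -> orient (a, b) \in [seq orient e | e <- tree_edges u f]).
Proof.
move=> hf; set es := map _ _; pose W w := w = u \/ infor w f.
have [[a [b h]]|no] := EM (exists a b, [/\ adj a b, W a & orient (a, b) \notin es]).
  by left; exists a, b.
have old a b : adj a b -> W a -> orient (a, b) \in es.
  move=> ab Wa; rewrite -[_ \in _]negbK; apply/negP => h.
  by apply: no; exists a, b.
have closed a b : adj a b -> W a -> W b.
  move=> ab Wa; have /mapP[[c d] cd] := old a b ab Wa.
  have [Wc hd] := tree_edges_ends cd.
  have Wd : W d by right.
  by rewrite /orient /=; case: ifP; case: ifP => _ _ [] *; subst.
have reach p x : path (@adj R T) x p -> W x -> W (last x p).
  elim: p x => //= c p IHp x /andP[xc hp] Wx.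
  by apply: IHp hp _; exact: closed xc Wx.
have [_ _ _ conn_all _] := treeP T.
right=> a b ab; have /connectP[p hp ea] := conn_all u a.
by apply: old ab _; rewrite ea; apply: reach hp _; left.
Qed.

(** New edges are added one by one; [n] bounds how many more can be added, since the oriented edges
    are distinct pairs. *)
Lemma spanning_forest u : exists f,
  [/\ tree_adj u f, uniq [seq orient e | e <- tree_edges u f] &
    forall a b, adj a b -> orient (a, b) \in [seq orient e | e <- tree_edges u f]].
Proof.
pose N := #|{: V * V}|.
suff grow n : forall f, tree_adj u f -> uniq [seq orient e | e <- tree_edges u f] ->
    (N <= n + size (tree_edges u f))%N -> exists f,
  [/\ tree_adj u f, uniq [seq orient e | e <- tree_edges u f] &
    forall a b, adj a b -> orient (a, b) \in [seq orient e | e <- tree_edges u f]].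
  by apply: (grow N Empty) => //=; rewrite addn0.
elim: n => [|n IHn] f hf uniq_f le_N.
  exists f; split=> // a b _.
  have : [seq orient e | e <- tree_edges u f] =i {: V * V}.
    apply/subset_cardP; last exact: subset_predT.
    apply/eqP; rewrite eqn_leq max_card /= (card_uniqP uniq_f) size_map.
    by move: le_N; rewrite add0n.
  by move=> ->.
have [[a [b [ab ha new]]]|all] := new_edge hf; last by exists f.
have [f' [hf' perm_f']] := insert_edge ab hf ha.
apply: (IHn f') => //; last by rewrite (perm_size perm_f') /= addnS.
by rewrite (perm_uniq (perm_map orient perm_f')) /= new.
Qed.

Lemma tree_len_edges u f :
  tree_len u f = \sum_(e <- tree_edges u f) len e.1 e.2.
Proof.
elim: f u => [|v s IHs r IHr] u /=; first by rewrite big_nil.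
by rewrite big_cons big_cat /= IHs IHr addrA.
Qed.

Lemma on_tree_edge u f a b y : (a, b) \in tree_edges u f ->
  segment a b 0 y -> on_tree u f y.
Proof.
elim: f u => //= v s IHs r IHr u.
rewrite inE mem_cat => /or3P[/eqP[-> ->]|h|h] aby; first exact: Or31.
- by apply: Or32; exact: IHs h aby.
by apply: Or33; exact: IHr h aby.
Qed.

Lemma segment_sym u v y : adj u v -> segment u v 0 y -> segment v u 0 y.
Proof.
move=> uv [s hs ey]; have e := len_sym u v.
exists (len u v - s); first by rewrite -e; lra.
case: ey => [[-> ->]|[-> ->]|[t [h [ht [et ->]]]]|[t [h [ht [et ->]]]]].
- by apply: Or42; rewrite subr0.
- by apply: Or41; rewrite subrr.
- by apply: Or44; exists t, h, ht; split=> //; rewrite -e et; ring.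
by apply: Or43; exists t, h, ht.
Qed.

Lemma tree_of_graph (u : V) : exists f,
  [/\ tree_adj u f, tree_len u f = total_length T &
    forall y, y = VertexPt u \/ on_tree u f y].
Proof.
have [f [hf uniq_f all_f]] := spanning_forest u; exists f; split=> //.
  have -> : total_length T = \sum_(e <- [seq orient e | e <- tree_edges u f]) len e.1 e.2.
    rewrite /total_length -big_filter; apply: perm_big; apply: uniq_perm => //.
      by rewrite filter_uniq// /index_enum -enumT enum_uniq.
    move=> e; rewrite mem_filter mem_index_enum andbT.
    apply/idP/idP => [|/mapP[[c d] cd ->]].
      case: e => a b /= ab; have -> : (a, b) = orient (a, b) by rewrite /orient ab.
      by apply: all_f; case/andP: ab.
    by apply: orient_oedge; exact: tree_edges_adj hf cd.
  rewrite tree_len_edges big_map; apply: eq_bigr => e _.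
  by rewrite /orient; case: ifP => // _; rewrite len_sym.
have on_adj a b y : adj a b -> segment a b 0 y -> on_tree u f y.
  move=> ab aby; have /mapP[[c d] cd] := all_f a b ab.
  have cd_adj := tree_edges_adj hf cd.
  have aby' := segment_sym ab aby.
  rewrite /orient /=; case: ifP; case: ifP => _ _ [] ? ?; subst;
    by apply: on_tree_edge cd _.
case=> [v|a b t e ht].
  have [->|nuv] := eqVneq v u; [by left|right].
  have [_ _ _ conn_all _] := treeP T.
  (* A vertex other than [u] lies on the first edge of a walk to [u]. *)
  have /connectP[p hp ep] := conn_all v u.
  case: p hp ep => [_ ep|w p /= /andP[vw _] _]; first by rewrite ep eqxx in nuv.
  apply: (on_adj v w) => //; exists 0; first by rewrite lexx ltW// len_gt0.
  exact: Or41.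
right; have ab : adj a b by case/andP: e.
apply: (on_adj a b) => //; exists t; last by apply: Or43; exists t, e, ht.
by have /andP[? ?] := ht; rewrite !ltW.
Qed.

End SpanningForest.

(** * Assembling the cover *)

Section BoundedUsage.
Variables (R : realFieldType) (X : eqType) (near : nat -> X -> X -> Prop).
Hypotheses (near0 : forall x, near 0 x x)
  (near_sym : forall n x y, near n x y -> near n y x)
  (near_trans : forall m n x y z, near m x y -> near n y z -> near (m + n) x z).

(** There are at most [n / S + 1] pieces. The square of one excess is at most the sum of all
    squares, hence at most [d ^+ 2], and quota plus [d] is at most [G]. *)
Lemma bounded_usage_cover (q S : nat) (v : X) (t : forest X) (d G : R) :
  (0 < q)%N -> (0 < S)%N -> hung near v t -> 0 <= d ->
  let n := (fsize t)%:R in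
  n / q%:R ^+ 2 + n / S%:R + 1 + d <= G ->
  (n / S%:R + 1) * q%:R * (2 * S).+1%:R ^+ 2 <= d ^+ 2 ->
  exists l : seq (X * nat), [/\ all (fun b => 0 < b.2 <= q)%N l,
    grants near l v 0 /\ forall y, infor y t -> grants near l y 0 &
    forall j, (0 < j <= q)%N -> (usage l j)%:R <= G].
Proof.
move=> q0 S0 ht d0 n le_G le_d.
have [t' [ps [lt_t' ht' ps_ok sz cov_ps]]] := cut_forest S0 ht.
pose P := (v, t') :: ps.
have P_ok p : p \in P -> (fsize p.2 < 2 * S)%N /\ hung near p.1 p.2.
  by rewrite inE => /orP[/eqP->|/ps_ok[/andP[_ ?] ?]]; split=> //=; lia.
have [l [ok_l cov_l le_l]] := balanced_cover R near0 near_sym near_trans q0 P_ok.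
have szS : (size ps)%:R <= n / S%:R.
  rewrite ler_pdivlMr ?ltr0n// -natrM ler_nat -sz.
  apply: (@leq_trans (\sum_(p <- ps) fsize p.2)); last exact: leq_addr.
  rewrite -sum1_size big_distrl /= big_seq [X in (_ <= X)%N]big_seq.
  by apply: leq_sum => p /ps_ok[/andP[? _] _]; rewrite mul1n.
have sq : \sum_(p <- P) (fsize p.2)%:R = n :> R.
  by rewrite big_cons /n -sz natrD addrC natr_sum.
have quotaP : quota R q P = n / q%:R ^+ 2 + (size ps).+1%:R.
  rewrite /quota big_split /= -mulr_suml sq; congr (_ + _).
  by rewrite -[(size ps).+1]/(size P) -sum1_size natr_sum.
exists l; split=> //.
  have [gv _] := cov_l (v, t') (mem_head _ _); split=> // y.
  move=> /cov_ps[yt'|[p pp yp]].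
    by have [_] := cov_l (v, t') (mem_head _ _); apply.
  have pP : p \in P by rewrite inE pp orbT.
  by have [_] := cov_l p pP; apply.
move=> j hj; set u := (usage l j)%:R.
have : Num.max (u - quota R q P) 0 ^+ 2 <= d ^+ 2.
  apply: le_trans le_d; apply: le_trans (le_trans le_l _).
    rewrite (bigD1_seq j) ?iota_uniq ?mem_index_iota//=.
      by rewrite lerDl sumr_ge0// => i _; rewrite sqr_ge0.
  rewrite -!mulrA ler_wpM2r ?mulr_ge0 ?exprn_ge0//.
  by rewrite /= -natr1 lerD2r.
rewrite ler_pXn2r ?nnegrE// ?le_max ?lexx ?orbT// => le_m.
have : u - quota R q P <= d by apply: le_trans le_m; rewrite le_max lexx.
rewrite quotaP -natr1; move: le_G szS; rewrite /n; lra.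
Qed.

End BoundedUsage.

Section GridBurning.
Variables (R : realType) (T : metric_tree R).

(* A ball with r steps of a grid of mesh g0 becomes a ball of radius (r+1)*g0
   in T; the g0 integers following (r+1)*g0 serve as radii for them. *)
Lemma usage_is_cover (g0 q k : nat) (v : vertex T) (F : forest (point T))
    (l : seq (point T * nat)) :
  (0 < g0)%N -> ((q + 2) * g0 <= k)%N ->
  all (fun b => 0 < b.2 <= q)%N l ->
  (forall j, (0 < j <= q)%N -> (usage l j <= g0)%N) ->
  (forall y, exists2 x, grants (near_grid g0%:R) l x 0 & conn x y (g0%:R : R)) ->
  is_cover T [seq i%:R | i <- iota 1 k].
Proof.
move=> g0_gt0 le_k ok_l le_u cov; split; first by move=> _ /mapP[i _ ->].
pose centers j := [seq b.1 | b <- l & b.2 == j].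
(* Index [i = j.+1 * g0 + n] with [n < g0] stands for the radius [i.+1] and serves the [n]-th ball
   of grid radius [j]. Surplus radii are centred at [v]. *)
exists (fun i => nth (VertexPt v) (centers (i %/ g0).-1) (i %% g0)).
apply/seteqP; split=> // y _ /=.
have [x [[c j] [i [bl /= ci le_j]]] xy] := cov y.
have hj : (0 < j <= q)%N by have := allP ok_l _ bl.
have cj : c \in centers j.
  by apply/mapP; exists (c, j) => //; rewrite mem_filter eqxx.
pose n := index c (centers j).
have lt_n : (n < g0)%N.
  rewrite -index_mem in cj; apply: leq_trans cj _.
  by rewrite size_map size_filter; exact: le_u.
pose r := (j.+1 * g0 + n)%N.
have lt_r : (r < k)%N.
  apply: leq_trans le_k; apply: (@leq_trans (j.+2 * g0)%N).
    by rewrite /r [(j.+2 * _)%N]mulSn addnC ltn_add2r.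
  by rewrite leq_mul2r; apply/orP; right; case/andP: hj; lia.
have sz : (r < size [seq i%:R : R | i <- iota 1 k])%N by rewrite size_map size_iota.
exists (Ordinal sz) => //=.
rewrite /tball /= (nth_map 0) ?size_iota// nth_iota//.
rewrite /r divnMDl// divn_small// addn0 /= modnMDl modn_small// nth_index//.
apply: conn_dist; apply: conn_le (conn_trans ci xy).
rewrite -[X in _ + X]mul1r -mulrDl -[1]/(1%:R) -natrD -natrM ler_nat.
apply: (@leq_trans (j.+1 * g0)%N); last by lia.
by rewrite leq_mul2r; apply/orP; right; lia.
Qed.

End GridBurning.

(** Passing from [q + 2] to [q] and from [x + 1] to [x] costs a factor of at most [1 + e / 16] each,
    hence its fourth power in [k ^+ 2]. That is at most [1 + e / 2], whose product with [1 - e] is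
    at most [1 - e / 2]. *)
Lemma grid_numerics (R : realType) (e x q k n : R) :
  0 < e -> e <= 1 -> 32 <= e * q -> 16 <= e * x ->
  k <= (q + 2) * (x + 1) -> 0 <= k -> x * n <= (1 - e) * k ^+ 2 ->
  n <= (1 - e / 2) * q ^+ 2 * x.
Proof.
move=> e0 e1 hq hx hk k0 hn.
have q_gt0 : 0 < q by rewrite -(pmulr_rgt0 _ e0); lra.
have x_gt0 : 0 < x by rewrite -(pmulr_rgt0 _ e0); lra.
have hq2 : q + 2 <= q * (1 + e / 16) by lra.
have hx2 : x + 1 <= x * (1 + e / 16) by lra.
pose f : R := 1 + e / 16.
have f_gt0 : 0 < f by rewrite /f; lra.
have kf : k <= (q * x) * f ^+ 2.
  apply: le_trans hk _; rewrite (_ : q * x * f ^+ 2 = (q * f) * (x * f)); last by ring.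
  by apply: ler_pM => //; lra.
have k2 : k ^+ 2 <= (q * x) ^+ 2 * (f ^+ 2) ^+ 2.
  by rewrite -exprMn ler_pXn2r ?nnegrE// mulr_ge0 ?exprn_ge0 ?mulr_ge0 ?ltW.
have f2 : f ^+ 2 <= 1 + 3 / 16 * e by rewrite /f; nra.
have f4 : (f ^+ 2) ^+ 2 <= 1 + e / 2.
  have f2_ge0 : 0 <= f ^+ 2 by rewrite exprn_ge0// ltW.
  by move: f2 f2_ge0; set y := f ^+ 2; nra.
have e4 : (1 - e) * (f ^+ 2) ^+ 2 <= 1 - e / 2.
  apply: (@le_trans _ _ ((1 - e) * (1 + e / 2))); last by nra.
  by rewrite ler_wpM2l//; lra.
rewrite -(ler_pM2l x_gt0); apply: le_trans hn _.
apply: (@le_trans _ _ ((1 - e) * ((q * x) ^+ 2 * (f ^+ 2) ^+ 2))).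
  by rewrite ler_wpM2l//; lra.
rewrite (_ : x * _ = (1 - e / 2) * (q * x) ^+ 2); last by ring.
by rewrite mulrCA mulrC ler_wpM2r// exprn_ge0// mulr_ge0// ltW.
Qed.

Theorem theorem5p3 (R : realType) (eps : R) (heps : 0 < eps) :
  exists K : nat, forall (k : nat) (T : metric_tree R),
    (K <= k)%N ->
    total_length T <= (1 - eps) * k%:R ^+ 2 ->
    is_cover T [seq i%:R | i <- iota 1 k].
Proof.
(* The cap at 1 keeps [1 - e] nonnegative. *)
pose e := Num.min eps 1.
have e0 : 0 < e by rewrite /e lt_min heps ltr01.
have e1 : e <= 1 by rewrite /e ge_min lexx orbT.
have e_eps : e <= eps by rewrite /e ge_min lexx.
have bound (x : R) : 0 <= x -> exists n : nat, (0 < n)%N /\ x <= e * n%:R.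
  move=> x0; exists (Num.bound (x / e)).+1; split=> //.
  rewrite mulrC -ler_pdivrMr//; apply: ltW.
  apply: lt_le_trans (archi_boundP _) _; first by rewrite divr_ge0// ltW.
  by rewrite ler_nat.
(* [q] makes the rounding losses small, [S] makes the number of pieces small against the mesh, and
   [x0], chosen last, makes the mesh large enough for [d ^+ 2] to absorb the sum of squares. *)
have [q [q0 hq]] : exists n : nat, (0 < n)%N /\ 32 <= e * n%:R by exact: bound.
have [S [S0 hS]] : exists n : nat, (0 < n)%N /\ 8 * q%:R ^+ 2 <= e * n%:R.
  by apply: bound; rewrite mulr_ge0 ?exprn_ge0.
pose Z : R := q%:R * (2 * S).+1%:R ^+ 2.
have Z1 : 1 <= Z.
  by rewrite /Z -natrX -natrM ler1n muln_gt0 q0 expn_gt0.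
have [x0 [x0_gt0 hx0]] : exists n : nat, (0 < n)%N /\ 16 * Z <= e * n%:R.
  by apply: bound; lra.
exists ((q + 2) * x0)%N => k T le_K le_len.
(* The mesh, and also the number of integers reserved for each grid radius; the first two blocks of
   [g0] integers are given up. *)
pose g0 := (k %/ (q + 2))%N.
have le_x0 : (x0 <= g0)%N by rewrite /g0 leq_divRL ?addn2// mulnC -addn2.
have g0_gt0 : (0 < g0)%N by apply: leq_trans le_x0.
have gR : 0 < g0%:R :> R by rewrite ltr0n.
have hx : 16 * Z <= e * g0%:R.
  by apply: le_trans hx0 _; rewrite ler_wpM2l ?ler_nat// ltW.
have [_ _ V0 _ _] := treeP T.
have /card_gt0P[v _] := V0.
have [f [hf len_f on_f]] := tree_of_graph v.
have [F [eta [/andP[eta0 eta_g] le_F rF cov_F]]] := netted_tree gR hf.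
have hF : hung (near_grid g0%:R) (VertexPt v) F := rooted_hung (ltW eta_g) rF.
set n : R := (fsize F)%:R.
have n0 : 0 <= n by [].
have le_n : n <= (1 - e / 2) * q%:R ^+ 2 * g0%:R.
  apply: (@grid_numerics R e g0%:R q%:R k%:R) => //; first by lra.
    rewrite -[1]/(1%:R) -!natrD -natrM ler_nat addn1 mulnC ltnW//.
    by rewrite ltn_ceil// addn2.
  apply: le_trans (_ : _ <= total_length T) _; first by rewrite -len_f; lra.
  by apply: le_trans le_len _; rewrite ler_wpM2r ?exprn_ge0//; lra.
have q2 : 0 < q%:R ^+ 2 :> R by rewrite exprn_gt0// ltr0n.
have nq : n / q%:R ^+ 2 <= (1 - e / 2) * g0%:R.
  by rewrite ler_pdivrMr// mulrAC.
have nS : n / S%:R <= e * g0%:R / 8.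
  rewrite ler_pdivrMr ?ltr0n//.
  have : (1 - e / 2) * q%:R ^+ 2 * g0%:R <= q%:R ^+ 2 * g0%:R.
    by rewrite ler_wpM2r// ler_piMl//; [rewrite ltW|lra].
  have : 8 * q%:R ^+ 2 * g0%:R <= e * S%:R * g0%:R by rewrite ler_wpM2r.
  lra.
(* The excess allowed per radius: [(1 - e / 2) + e / 8 + e / 8] times [g0], plus 1, still fits into
   [g0]. *)
pose d := e * g0%:R / 8.
have near_grid0 (x : point T) : near_grid g0%:R 0 x x.
  by apply: conn_refl; rewrite mul0r.
have near_grid_sym m (x y : point T) :
    near_grid g0%:R m x y -> near_grid g0%:R m y x by exact: conn_sym.
have near_grid_trans m m' (x y z : point T) : near_grid g0%:R m x y ->
    near_grid g0%:R m' y z -> near_grid g0%:R (m + m') x z.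
  by move=> xy yz; rewrite /near_grid natrD mulrDl; exact: conn_trans xy yz.
have d2 : 2 * Z <= d by rewrite /d; lra.
have [|||l [ok_l [gv gF] le_u]] := bounded_usage_cover near_grid0 near_grid_sym
    near_grid_trans q0 S0 hF (_ : 0 <= d) (_ : _ <= g0%:R) _; rewrite -/n.
- by lra.
- by rewrite -/d in nS *; move: nq nS d2; rewrite /d; lra.
(* Both [n / S] and 1 are at most [d], so the left side is at most [2 * d * Z], and [2 * Z <= d]. *)
- rewrite -mulrA -/Z; apply: (@le_trans _ _ (2 * d * Z)).
    by rewrite ler_wpM2r; rewrite -/d in nS *; lra.
  by rewrite expr2 mulrAC [leLHS]mulrC mulrC; nra.
apply: (@usage_is_cover _ _ g0 q k v F l) => //.
- by rewrite mulnC /g0 leq_trunc_div.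
- by move=> j hj; rewrite -(@ler_nat R); exact: le_u.
move=> y; have [->|/cov_F[py|[x xF xy]]] := on_f y.
- by exists (VertexPt v) => //; apply: conn_refl; exact: ltW.
- by exists (VertexPt v) => //; apply: conn_le py; exact: ltW.
by exists x => //; exact: gF.
Qed.
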